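(* Given a CB representation of an $n$-vertex graph $G$, where the underlying biclique partition has weight $O(n^2/\lg n)$, and any $\alpha>1$, one can compute a $2\alpha$-approximation for the densest subgraph problem on $G$ in time $O(n^2/\lg\alpha)$.
   Context: All graphs are finite, simple and undirected; $\lg$ is the base-2 logarithm. A biclique of a graph $G$ is a (not necessarily induced) complete bipartite subgraph $(L,R)$ of $G$ with sides $L$ and $R$. A biclique partition of $G$ is a family $\mathcal B=\{(L_1,R_1),\dots,(L_k,R_k)\}$ of bicliques of $G$ whose edge sets partition $E(G)$; its weight is $\sum_{i=1}^k (|L_i|+|R_i|)$. The CB (compact biclique) representation of $G$ based on a biclique partition $\mathcal B$ consists of: (1) a list of the bicliques, where each biclique is stored as two sorted lists of vertices (its left side $L_i$ and its right side $R_i$), together with the lengths of these lists; and (2) for each vertex $v$, a list of pointers to the bicliques $(L_i,R_i)$ that $v$ belongs to, together with one bit per such biclique recording whether $v\in L_i$ or $v\in R_i$. The densest subgraph problem: given $G=(V,E)$, find a nonempty $S\subseteq V$ maximizing $\delta(S)=|E(G[S])|/|S|$. A $c$-approximation is a nonempty $S\subseteq V$ with $\delta(S)\ge \frac1c\max_{\emptyset\ne S'\subseteq V}\delta(S')$. Running times are in the standard word-RAM model with words of $\Theta(\lg n)$ bits.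
   Formalization: The running time is proved as O(max(1, n^2/lg α)) instead of O(n^2/lg α): for α far above 2^(n^2) the literal bound drops below one step, which no algorithm can meet; for α ≤ 2^(n^2) the bounds coincide. *)

(* Defs.v *)
From HB Require Import structures.
From mathcomp Require Import all_boot all_order all_algebra.
From mathcomp Require Import reals exp.

Set Implicit Arguments.
Unset Strict Implicit.
Unset Printing Implicit Defensive.

Import Order.TTheory GRing.Theory Num.Theory.

(** * Graphs and densest subgraphs *)

Record sgraph (n : nat) := SGraph {
  adj :> rel 'I_n;
  adj_sym : symmetric adj;
  adj_irr : irreflexive adj }.

(* The edges of G[S], an edge being the two-element set of its ends. *)
Definition edges_in n (G : sgraph n) (S : {set 'I_n}) : {set {set 'I_n}} :=
  [set [set x; y] | x in S, y in S & G x y].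

Definition edges n (G : sgraph n) : {set {set 'I_n}} := edges_in G [set: 'I_n].

Definition density (R : realType) n (G : sgraph n) (S : {set 'I_n}) : R :=
  (#|edges_in G S|%:R / #|S|%:R)%R.

(* Densities are nonnegative, so the neutral element 0 does not affect the
   maximum. *)
Definition max_density (R : realType) n (G : sgraph n) : R :=
  (\big[Num.max/0]_(S : {set 'I_n} | S != set0) density R G S)%R.

Definition approx_densest (R : realType) n (G : sgraph n) (c : R)
    (S : {set 'I_n}) : Prop :=
  S != set0 /\ (c^-1 * max_density R G <= density R G S)%R.

(** * Biclique partitions *)

Notation vpair n := ({set 'I_n} * {set 'I_n})%type.

(* Sides are nonempty: a biclique of a partition has at least one edge. *)
Definition is_biclique n (G : sgraph n) (b : vpair n) : Prop :=
  [/\ b.1 != set0, b.2 != set0, [disjoint b.1 & b.2]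
    & {in b.1 & b.2, forall x y, G x y}].

Definition biclique_edges n (b : vpair n) : {set {set 'I_n}} :=
  [set [set x; y] | x in b.1, y in b.2].

Definition biclique_partition n (G : sgraph n) (B : seq (vpair n)) : Prop :=
  (forall b, b \in B -> is_biclique G b) /\
  (forall f, f \in edges G -> count (fun b => f \in biclique_edges b) B = 1).

Definition weight n (B : seq (vpair n)) : nat :=
  \sum_(b <- B) (#|b.1| + #|b.2|).

(** * The CB representation *)

(* A pointer (i, s) in [cb_pointers v] designates the i-th biclique; the bit s
   is false when v is on the left side and true when v is on the right side. *)
Record cb_rep (n : nat) := CBRep {
  cb_lists : seq (seq 'I_n * seq 'I_n);
  cb_pointers : 'I_n -> seq (nat * bool) }.

Definition cb_represents n (B : seq (vpair n)) (r : cb_rep n) : Prop :=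
  [/\ B = [seq ([set v in l.1], [set v in l.2]) | l <- cb_lists r],
      forall l, l \in cb_lists r ->
        sorted ltn (map val l.1) /\ sorted ltn (map val l.2),
      forall v, uniq (cb_pointers r v)
    & forall v i (s : bool), ((i, s) \in cb_pointers r v) =
        (i < size B) &&
        (let b := nth (set0, set0) B i in v \in (if s then b.2 else b.1)) ].

(** * The word RAM

    Words are the naturals below 2 ^ w.  A program uses finitely many
    registers, and a memory addressed by words; every primitive operation and
    every test takes one unit of time. *)

Inductive binop :=
  | OAdd | OSub | OMul | ODiv | OMod
  | OAnd | OOr | OXor | OShl | OShr | OLt | OEq.

Definition eval_binop (w : nat) (o : binop) (x y : nat) : nat :=
  (match o with
   | OAdd => x + y
   | OSub => x + 2 ^ w - y
   | OMul => x * y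
   | ODiv => x %/ y
   | OMod => x %% y
   | OAnd => Nat.land x y
   | OOr => Nat.lor x y
   | OXor => Nat.lxor x y
   | OShl => x * 2 ^ y
   | OShr => x %/ 2 ^ y
   | OLt => x < y
   | OEq => x == y
   end) %% 2 ^ w.

Inductive prog :=
  | Const (d c : nat)                  (* reg d := c *)
  | Op (o : binop) (d a b : nat)       (* reg d := reg a o reg b *)
  | Read (d a : nat)                   (* reg d := mem (reg a) *)
  | Write (a b : nat)                  (* mem (reg a) := reg b *)
  | Seq (p q : prog)
  | If (a : nat) (p q : prog)          (* p if reg a is nonzero, else q *)
  | While (a : nat) (p : prog).        (* repeat p while reg a is nonzero *)

Record state := State { reg : nat -> nat; mem : nat -> nat }.

Definition upd (f : nat -> nat) (i x : nat) : nat -> nat :=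
  fun j => if j == i then x else f j.

Definition set_reg (s : state) (d x : nat) : state :=
  State (upd (reg s) d x) (mem s).

Definition set_mem (s : state) (a x : nat) : state :=
  State (reg s) (upd (mem s) a x).

(* [exec w p s s' t]: on words of w bits, p started in s halts in s' after
   t units of time. *)
Inductive exec (w : nat) : prog -> state -> state -> nat -> Prop :=
  | ExecConst d c s :
      exec w (Const d c) s (set_reg s d (c %% 2 ^ w)) 1
  | ExecOp o d a b s :
      exec w (Op o d a b) s
        (set_reg s d (eval_binop w o (reg s a) (reg s b))) 1
  | ExecRead d a s :
      exec w (Read d a) s (set_reg s d (mem s (reg s a))) 1
  | ExecWrite a b s :
      exec w (Write a b) s (set_mem s (reg s a) (reg s b)) 1
  | ExecSeq p q s s' s'' t t' :
      exec w p s s' t -> exec w q s' s'' t' -> exec w (Seq p q) s s'' (t + t')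
  | ExecIfTrue a p q s s' t :
      reg s a != 0 -> exec w p s s' t -> exec w (If a p q) s s' t.+1
  | ExecIfFalse a p q s s' t :
      reg s a = 0 -> exec w q s s' t -> exec w (If a p q) s s' t.+1
  | ExecWhileTrue a p s s' s'' t t' :
      reg s a != 0 -> exec w p s s' t -> exec w (While a p) s' s'' t' ->
      exec w (While a p) s s'' (t + t').+1
  | ExecWhileFalse a p s :
      reg s a = 0 -> exec w (While a p) s s 1.

(** * Memory layout of the input and the output

    The input occupies an initial segment of the memory:
    - n, the number k of bicliques, and one word for alpha;
    - a directory with one entry (length, address) per block, in the order
      L_0, R_0, ..., L_(k-1), R_(k-1), then one block per vertex;
    - the blocks themselves, in the same order.
    The record of biclique i is thus formed of the four words that start at
    [biclique_addr i], and pointers to bicliques are these addresses.  In the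
    block of a vertex each pointer is followed by a word holding its bit;
    lengths in the directory are numbers of words. *)

Definition header_size : nat := 3.

Definition biclique_addr (i : nat) : nat := header_size + 4 * i.

Definition cb_blocks n (r : cb_rep n) : seq (seq nat) :=
  flatten [seq [:: map val l.1; map val l.2] | l <- cb_lists r] ++
  [seq flatten [seq [:: biclique_addr p.1; nat_of_bool p.2]
               | p <- cb_pointers r v]
  | v <- enum 'I_n].

Definition directory (base : nat) (ss : seq (seq nat)) : seq nat :=
  flatten [seq [:: size (nth [::] ss j); base + size (flatten (take j ss))]
          | j <- iota 0 (size ss)].

(* The machine receives the real alpha as a fixed-point number with unit 1/n,
   rounded down and capped at the largest word. *)
Definition alpha_word (R : realType) (w n : nat) (alpha : R) : nat :=
  minn (Num.truncn (alpha * n%:R)%R) (2 ^ w).-1.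

Definition cb_input (R : realType) (w n : nat) (r : cb_rep n) (alpha : R) :
    seq nat :=
  let ss := cb_blocks r in
  [:: n; size (cb_lists r); alpha_word w n alpha] ++
  directory (header_size + 2 * size ss) ss ++ flatten ss.

Definition init_state (input : seq nat) : state :=
  State (fun=> 0) (nth 0 input).

(* On halting, register 0 holds |S| and register 1 the address of a list, in
   any order and without repetition, of the elements of S. *)
Definition outputs (w n : nat) (s : state) (S : {set 'I_n}) : Prop :=
  exists l : seq 'I_n,
    [/\ uniq l, S = [set v in l], reg s 0 = size l,
        reg s 1 + size l <= 2 ^ w
      & [seq mem s (reg s 1 + j) | j <- iota 0 (size l)] = map val l].

(** * Asymptotics *)

Definition lg (R : realType) (x : R) : R := (ln x / ln 2)%R.

(* Main.v *)
Require Import Defs.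
From mathcomp Require Import all_boot all_order all_algebra.
From mathcomp Require Import reals exp.
From mathcomp Require Import zify ring lra.

(** Peeling.  From a vertex set S with e edges and z vertices, delete every
    vertex of degree at most alpha times the average degree 2 e / z, repeat
    until nothing is left, and keep the densest of the sets S met at the
    beginning of a round.

    Approximation.  Let D be 2 alpha times the density of the set that is kept.
    Each deleted vertex has degree at most D when it goes, so by induction every
    vertex set T satisfies e(T) <= e(T cap S) + D |T - S| for the current S
    ([covers_light]); when S is empty this says that no density exceeds D.

    Number of rounds.  The survivors of a round have degree above alpha times
    the average while their degrees add up to at most 2 e, so fewer than
    z / alpha of them are left ([heavy_shrink]).  The machine only knows the
    rounded value A / n of alpha; since moreover a round always deletes a
    vertex, the rounding costs at most the replacement of alpha by its square
    root ([round_shrinks]), and 2 lg n / lg alpha + 1 rounds are enough.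

    Cost of a round.  The neighbours of v are the disjoint union, over the
    bicliques containing v, of the sides opposite to v ([degree_pointers]).
    With one counter per side holding the number of its surviving vertices, the
    degree of v is a sum with one term per pointer of v, and deleting v
    decrements one counter per pointer.  A round is one pass over the pointers
    and takes time O(n + weight), which is O(n^2 / lg n), hence a total of
    O(n^2 / lg alpha) as long as alpha < n.

    For alpha >= n this time may be too short to read the input.  Then the two
    ends of any edge have density at least 1/2, whereas no density exceeds
    n / 2, so that the first biclique gives an answer in constant time
    ([approx_edge]).

    The program is verified in a small logic of total correctness with explicit
    time bounds, [halts]. *)

Set Implicit Arguments.
Unset Strict Implicit.
Unset Printing Implicit Defensive.

(** * Edges and degrees *)

Section Graph.
Context {n : nat} (G : sgraph n).
Implicit Types (S T : {set 'I_n}) (u v : 'I_n).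

Definition num_edges S : nat := #|edges_in G S|.

Definition degree_in S v : nat := #|[set u in S | G v u]|.

Lemma edges_inP S f :
  reflect (exists x y, [/\ x \in S, y \in S, G x y & f = [set x; y]])
          (f \in edges_in G S).
Proof.
apply: (iffP imset2P) => [[x y xS]|[x [y [xS yS Gxy ->]]]].
  by rewrite inE => /andP[yS Gxy] ->; exists x, y.
by exists x y; rewrite ?inE ?yS.
Qed.

Lemma adj_neq u v : G u v -> u != v.
Proof. by case: eqP => // ->; rewrite adj_irr. Qed.

(** The map u |-> {v, u} is injective on the neighbours of v. *)
Lemma card_incident_edges S v : v \in S ->
  #|[set f in edges_in G S | v \in f]| = degree_in S v.
Proof.
move=> vS; have inj : {in [set u in S | G v u] &, injective (fun u => [set v; u])}.
  move=> x y; rewrite !inE => /andP[_ /adj_neq vx] /andP[_ /adj_neq vy] E.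
  have: x \in [set v; y] by rewrite -E !inE eqxx orbT.
  by rewrite !inE eq_sym (negPf vx) => /eqP.
rewrite /degree_in -(card_in_imset inj); congr #|pred_of_set _|.
apply/setP=> f; rewrite inE; apply/andP/imsetP.
  case=> /edges_inP[x [y [xS yS Gxy ->]]]; rewrite !inE => /orP[]/eqP ->.
    by exists y; rewrite ?inE ?yS.
  by exists x; rewrite ?inE ?xS 1?adj_sym // setUC.
case=> u; rewrite inE => /andP[uS Gvu] ->; rewrite !inE eqxx; split=> //.
by apply/edges_inP; exists v, u.
Qed.

Lemma num_edges_del S v : v \in S ->
  num_edges S = num_edges (S :\ v) + degree_in S v.
Proof.
move=> vS; rewrite /num_edges -(card_incident_edges vS) addnC -(cardsID [set f :
    {set 'I_n} | v \in f]).
congr (_ + _).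
  by congr #|pred_of_set _|; apply/setP=> f; rewrite !inE.
congr #|pred_of_set _|; apply/setP=> f; rewrite !inE andbC.
apply/andP/edges_inP.
  case=> /edges_inP[x [y [xS yS Gxy ->]]]; rewrite !inE => /norP[vx vy].
  by exists x, y; rewrite !inE ?xS ?yS ![_ == v]eq_sym vx vy.
case=> x [y [+ + Gxy ->]]; rewrite !inE => /andP[xv xS] /andP[yv yS].
by split; [apply/edges_inP; exists x, y | rewrite ![v == _]eq_sym negb_or xv yv].
Qed.

Lemma degree_inS S T v : S \subset T -> degree_in S v <= degree_in T v.
Proof.
move=> ST; apply: subset_leq_card; apply/subsetP=> u; rewrite !inE.
by case/andP=> /(subsetP ST) -> ->.
Qed.

Lemma degree_in_le S v : degree_in S v <= n.
Proof. by rewrite (leq_trans (max_card _)) ?card_ord. Qed.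

Lemma card_edge S f : f \in edges_in G S -> #|f| = 2 /\ f \subset S.
Proof.
case/edges_inP=> x [y [xS yS Gxy ->]]; rewrite cards2 adj_neq //.
by split=> //; rewrite subUset !sub1set xS.
Qed.

(** Both sides count the pairs of an edge and one of its ends. *)
Lemma handshake S : \sum_(v in S) degree_in S v = 2 * num_edges S.
Proof.
transitivity (\sum_(v in S) \sum_(f in edges_in G S) (v \in f : nat)).
  apply: eq_bigr => v vS; rewrite -card_incident_edges // -sum1_card.
  rewrite [LHS](eq_bigl (fun f => (f \in edges_in G S) && (v \in f))).
    by rewrite big_mkcondr /=; apply: eq_bigr => f _; case: (v \in f).
  by move=> f; rewrite inE.
rewrite exchange_big mulnC -sum_nat_const; apply: eq_bigr => f /card_edge[<- fS].
rewrite -big_mkcondr /= sum1_card; apply: eq_card => v.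
rewrite -[LHS]/((v \in S) && (v \in f)).
by case vf : (v \in f); rewrite ?andbF // (subsetP fS).
Qed.

Lemma num_edges_le S : num_edges S <= n * n.
Proof.
suff: 2 * num_edges S <= n * n by lia.
rewrite -handshake; apply: (@leq_trans (\sum_(v in S) n)).
  by apply: leq_sum => v _; apply: degree_in_le.
by rewrite sum_nat_const leq_mul2r (leq_trans (max_card _)) ?card_ord ?orbT.
Qed.

Lemma num_edges0 : num_edges set0 = 0.
Proof. by have := handshake set0; rewrite big_set0; lia. Qed.

(** The edges lost with v number its degree in [T :&: S], and degrees only grow
    with the vertex set. *)
Lemma num_edges_setI_del S T v : v \in S ->
  num_edges (T :&: S) <= num_edges (T :&: (S :\ v)) + (v \in T) * degree_in S v.
Proof.
move=> vS; have -> : T :&: (S :\ v) = (T :&: S) :\ v by rewrite setIDA.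
case: (boolP (v \in T)) => vT; last first.
  suff -> : (T :&: S) :\ v = T :&: S by rewrite leq_addr.
  by apply/setDidPl; rewrite disjoint_sym disjoints1 inE negb_and vT.
rewrite (@num_edges_del _ v) ?inE ?vT // mul1n leq_add2l.
by rewrite degree_inS ?subsetIr.
Qed.

Lemma card_setD_del (S T : {set 'I_n}) v : v \in S ->
  #|T :\: (S :\ v)| = #|T :\: S| + (v \in T).
Proof.
move=> vS; rewrite (cardsD1 v) addnC !inE eqxx /=; congr (_ + _).
apply: eq_card => u; rewrite !inE.
by case: eqP => [->|]; rewrite ?vS //= andbF.
Qed.

End Graph.

(** * Degrees from a biclique partition *)

(** Sides are indexed like pointers; an index out of range gives the empty
    set. *)
Definition side n (B : seq (vpair n)) (p : nat * bool) : {set 'I_n} :=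
  let b := nth (set0, set0) B p.1 in if p.2 then b.2 else b.1.

Definition opposite (p : nat * bool) : nat * bool := (p.1, ~~ p.2).

Arguments side : simpl never.
Arguments opposite : simpl never.

Definition side_count n (B : seq (vpair n)) (S : {set 'I_n}) p : nat :=
  #|side B p :&: S|.

Section Bicliques.
Context {n : nat} (G : sgraph n) (B : seq (vpair n)) (r : cb_rep n).
Hypothesis partB : biclique_partition G B.
Hypothesis repB : cb_represents B r.

(** An edge lies in exactly one biclique, with its ends on opposite sides, and
    two nonadjacent vertices never lie on opposite sides of a biclique. *)
Lemma adj_count u v :
  G v u = \sum_(b <- B) ((v \in b.1) * (u \in b.2) + (v \in b.2) * (u \in b.1))
  :> nat.
Proof.
have [bicB cntB] := partB.
have term b : b \in B ->
    (v \in b.1) * (u \in b.2) + (v \in b.2) * (u \in b.1)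
    = ([set v; u] \in biclique_edges b) && G v u.
  move=> /bicB[_ _ /pred0P disj Gb].
  have dis x : (x \in b.1) && (x \in b.2) = false := disj x.
  have -> : ([set v; u] \in biclique_edges b) && G v u
     = (v \in b.1) && (u \in b.2) || (v \in b.2) && (u \in b.1).
    apply/idP/idP => [/andP[/imset2P[x y xb yb E] Gvu]|].
      have := set21 v u; have := set22 v u; rewrite E !inE.
      have := adj_neq Gvu.
      move=> neq /orP[]/eqP uE /orP[]/eqP vE; move: neq;
        by rewrite uE vE ?eqxx ?xb ?yb ?orbT.
    have edge x y : x \in b.1 -> y \in b.2 -> [set x; y] \in biclique_edges b.
      by move=> xb yb; apply/imset2P; exists x y.
    case/orP=> /andP[vb ub]; first by rewrite edge ?Gb.
    by rewrite setUC adj_sym edge ?Gb.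
  have := dis u; have := dis v.
  by case: (v \in b.1); case: (v \in b.2); case: (u \in b.1); case: (u \in b.2).
rewrite big_seq (eq_bigr _ term) -big_seq.
case Gvu: (G v u); last by rewrite big1 // => b _; rewrite andbF.
have /cntB cnt1 : [set v; u] \in edges G.
  by apply/edges_inP; exists v, u; rewrite !inE.
rewrite -[LHS]cnt1 -sum1_count big_mkcond.
by apply: eq_bigr => b _; rewrite andbT; case: ifP.
Qed.

Lemma sum_pointers (F : nat * bool -> nat) v :
  \sum_(p <- cb_pointers r v) F p
  = \sum_(i < size B) ((v \in side B (nat_of_ord i, false)) * F (nat_of_ord i, false)
                     + (v \in side B (nat_of_ord i, true)) * F (nat_of_ord i, true)).
Proof.
have [_ _ uniq_ptr mem_ptr] := repB.
pose all_p := [seq (i, s) | i <- iota 0 (size B), s <- [:: false; true]].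
have perm_p : perm_eq (cb_pointers r v) [seq p <- all_p | v \in side B p].
  apply: uniq_perm => //; first by apply/filter_uniq/allpairs_uniq; rewrite
      ?iota_uniq // => -[? ?] [].
  move=> [i s]; rewrite mem_ptr mem_filter [RHS]andbC; congr (_ && _).
  apply/idP/allpairsP => [ltiB|[[j s'] [/= + _ [-> _]]]]; last by rewrite
      mem_iota add0n.
  by exists (i, s); split; rewrite ?mem_iota //=; case: (s).
rewrite (perm_big _ perm_p) big_filter big_mkcond big_allpairs -(big_mkord xpredT
 (fun i => (v \in side B (i, false)) * F (i, false) + (v \in side B (i, true)) *
     F (i, true))).
rewrite /index_iota subn0; apply: eq_bigr => i _; rewrite !big_cons big_nil
    Monoid.mulm1 /=.
by do 2 case: ifP => _; rewrite ?mul1n ?mul0n.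
Qed.

(** The neighbours of v are the disjoint union of the sides opposite to v. *)
Lemma degree_pointers S v :
  degree_in G S v = \sum_(p <- cb_pointers r v) side_count B S (opposite p).
Proof.
rewrite sum_pointers /side_count /opposite /=.
have cardE (A : {set 'I_n}) : #|A :&: S| = \sum_(u in S) (u \in A).
  rewrite -sum1_card big_mkcond [RHS]big_mkcond; apply: eq_bigr => u _.
  by rewrite inE; case: (u \in A); case: (u \in S).
transitivity (\sum_(u in S) \sum_(b <- B) 
   ((v \in b.1) * (u \in b.2) + (v \in b.2) * (u \in b.1))).
  rewrite /degree_in -sum1_card.
  rewrite (eq_bigl (fun u => (u \in S) && G v u)) => [|u]; last by rewrite inE.
  by rewrite big_mkcondr; apply: eq_bigr => u _; rewrite -adj_count; case: (G v u).
rewrite exchange_big (big_nth (set0, set0)) big_mkord; apply: eq_bigr => i _.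
by rewrite /side /= !cardE big_split !big_distrr.
Qed.

(** Hence one pass over all the pointers costs a constant times the weight. *)
Lemma sum_size_pointers : \sum_(v : 'I_n) size (cb_pointers r v) = weight B.
Proof.
transitivity (\sum_(v : 'I_n) \sum_(p <- cb_pointers r v) 1).
  by apply: eq_bigr => v _; rewrite sum1_size.
under eq_bigr => v _ do rewrite sum_pointers.
rewrite exchange_big /weight (big_nth (set0, set0)) big_mkord.
apply: eq_bigr => i _; under eq_bigr => v _ do rewrite !muln1.
rewrite big_split /side /= -!sum1_card.
by congr (_ + _); rewrite [RHS]big_mkcond; apply: eq_bigr => v _; case: (v \in _).
Qed.

Lemma size_le_weight : size B <= weight B.
Proof.
rewrite -sum1_size /weight [X in X <= _]big_seq [X in _ <= X]big_seq.
by apply: leq_sum => b /partB.1[b1 _ _ _]; rewrite addn_gt0 card_gt0 b1.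
Qed.

End Bicliques.

(** * Layout of the input *)

Section Layout.

Lemma size_flatten_pairs T U (f g : T -> U) (s : seq T) :
  size (flatten [seq [:: f x; g x] | x <- s]) = 2 * size s.
Proof. by elim: s => //= x s ->; lia. Qed.

(** Both the directory and the vertex blocks are sequences of pairs of words. *)
Lemma nth_flatten_pairs T (f g : T -> nat) x0 (s : seq T) j : j < size s ->
  let t := flatten [seq [:: f x; g x] | x <- s] in
  nth 0 t (2 * j) = f (nth x0 s j) /\ nth 0 t (2 * j + 1) = g (nth x0 s j).
Proof.
elim: s j => // x s IH [|j] // /IH{IH} IH t.
by have -> : 2 * j.+1 = (2 * j).+2 by lia.
Qed.

Lemma size_flatten_take (ss : seq (seq nat)) j :
  size (flatten (take j ss)) + size (nth [::] ss j) <= size (flatten ss).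
Proof.
elim: ss j => [|t ss IH] [|j] //=; rewrite !size_cat ?add0n ?leq_addr //.
by rewrite -addnA leq_add2l.
Qed.

Lemma nth_flatten_take (ss : seq (seq nat)) j q : q < size (nth [::] ss j) ->
  nth 0 (flatten ss) (size (flatten (take j ss)) + q) = nth 0 (nth [::] ss j) q.
Proof.
elim: ss j => [|t ss IH] [|j] //= qlt; first by rewrite nth_cat qlt.
by rewrite size_cat -addnA nth_cat ltnNge leq_addr addKn IH.
Qed.

Lemma size_flatten_sum (ss : seq (seq nat)) :
  size (flatten ss) = \sum_(t <- ss) size t.
Proof. by elim: ss => [|t ss IH]; rewrite ?big_nil ?big_cons //= size_cat IH. Qed.

Context {n : nat} (r : cb_rep n).
Let blocks := cb_blocks r.
Let k := size (cb_lists r).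

Lemma size_cb_blocks : size blocks = 2 * k + n.
Proof. by rewrite size_cat size_flatten_pairs size_map size_enum_ord. Qed.

Lemma nth_cb_blocks_vertex v :
  nth [::] blocks (2 * k + nat_of_ord v) = flatten
    [seq [:: biclique_addr p.1; nat_of_bool p.2] | p <- cb_pointers r v].
Proof.
rewrite nth_cat size_flatten_pairs -/k ltnNge leq_addr addKn.
by rewrite (nth_map v) ?size_enum_ord // nth_ord_enum.
Qed.

Lemma nth_cb_blocks_side i (s : bool) : i < k ->
  nth [::] blocks (2 * i + s) =
  map val (let l := nth ([::], [::]) (cb_lists r) i in if s then l.2 else l.1).
Proof.
rewrite nth_cat size_flatten_pairs -/k => lti.
have -> : 2 * i + s < 2 * k by case: (s); lia.
rewrite /k; elim: (cb_lists r) i @k lti => // l ls IH [|i] lti.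
  by case: (s).
have -> : 2 * i.+1 + s = (2 * i + s).+2 by lia.
exact: IH.
Qed.

Variables (R : realType) (w : nat) (alpha : R).
Let input := cb_input w r alpha.
Let base := header_size + 2 * size blocks.

Definition block_addr j := base + size (flatten (take j blocks)).

Lemma size_cb_input : size input = base + size (flatten blocks).
Proof.
by rewrite size_cat /= size_cat /directory size_flatten_pairs size_iota.
Qed.

Lemma cb_input_directory j : j < size blocks ->
  nth 0 input (header_size + 2 * j) = size (nth [::] blocks j) /\
  nth 0 input (header_size + 2 * j + 1) = block_addr j.
Proof.
move=> ltj; have skip i : i < 2 * size blocks ->
    nth 0 input (header_size + i) = nth 0 (directory base blocks) i.
  by rewrite -[LHS]/(nth 0 (_ ++ _) i) nth_cat size_flatten_pairs size_iota => ->.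
rewrite -[_ + 1]addnA !skip; try lia.
have := @nth_flatten_pairs _ (fun j => size (nth [::] blocks j)) block_addr
  0 (iota 0 (size blocks)) j.
by rewrite size_iota nth_iota // => /(_ ltj).
Qed.

Lemma cb_input_block j q : q < size (nth [::] blocks j) ->
  nth 0 input (block_addr j + q) = nth 0 (nth [::] blocks j) q.
Proof.
move=> ltq; rewrite -(nth_flatten_take ltq) /block_addr -addnA.
set m := _ + q; rewrite -addnA -[LHS]/(nth 0 (_ ++ _) (2 * size blocks + m)).
by rewrite nth_cat size_flatten_pairs size_iota ltnNge leq_addr addKn.
Qed.

Lemma block_addr_le j :
  block_addr j + size (nth [::] blocks j) <= size input.
Proof. by rewrite size_cb_input -addnA leq_add2l size_flatten_take. Qed.

(** This is how the program finds the free memory: the last directory entry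
    tells where the input ends. *)
Lemma last_block_addr j : size blocks = j.+1 ->
  block_addr j + size (nth [::] blocks j) = size input.
Proof.
move=> sz; rewrite size_cb_input /block_addr -addnA; congr (_ + _).
have -> : flatten blocks = flatten (take j blocks ++ [:: nth [::] blocks j]).
  by rewrite cats1 -take_nth ?sz // take_oversize // sz.
by rewrite flatten_cat size_cat /= cats0.
Qed.

End Layout.

(** * The program *)

(** The unqualified name denotes the membership predicates of [ssrbool]. *)
Notation memory := Defs.mem (only parsing).

(** Registers 0 and 1 are kept for the output. *)

Notation rZero := 2 (only parsing).
Notation rOne := 3 (only parsing).
Notation rTwo := 4 (only parsing).
Notation rN := 5 (only parsing).
Notation rK := 6 (only parsing).
Notation rAlpha := 7 (only parsing).
Notation rDir := 8 (only parsing).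
Notation rOrder := 9 (only parsing).
Notation rDead := 10 (only parsing).
Notation rCount := 11 (only parsing).
Notation rV := 12 (only parsing).
Notation rVDir := 13 (only parsing).
Notation rVMore := 14 (only parsing).
Notation rEdges := 15 (only parsing).
Notation rSize := 16 (only parsing).
Notation rBestEdges := 17 (only parsing).
Notation rBestSize := 18 (only parsing).
Notation rRhs := 19 (only parsing).
Notation rSizeN := 20 (only parsing).
Notation rT := 21 (only parsing).
Notation rU := 22 (only parsing).
Notation rP := 23 (only parsing).
Notation rEnd := 24 (only parsing).
Notation rPMore := 25 (only parsing).
Notation rX := 26 (only parsing).
Notation rBit := 27 (only parsing).
Notation rY := 28 (only parsing).
Notation rDeg := 29 (only parsing).
Notation rJunk := 30 (only parsing).

(** There is no empty program, so the end of a block is a harmless write. *)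
Definition block (l : seq prog) : prog := foldr Seq (Const rJunk 0) l.
Arguments block : simpl never.

(** Register [rVDir] holds the address of the directory entry of the vertex.
    The body finds the address of a biclique record in [rX] and the bit of the
    pointer in [rBit]. *)
Definition for_pointers (body : prog) : prog := block
  [:: Read rEnd rVDir; Op OAdd rT rVDir rOne; Read rP rT;
      Op OAdd rEnd rP rEnd; Op OLt rPMore rP rEnd;
      While rPMore (block
        [:: Read rX rP; Op OAdd rT rP rOne; Read rBit rT;
            body;
            Op OAdd rP rP rTwo; Op OLt rPMore rP rEnd])].

Definition for_vertices (body : prog) : prog := block
  [:: Const rV 0; Op OAdd rVDir rDir rZero; Op OLt rVMore rV rN;
      While rVMore (block
        [:: body;
            Op OAdd rV rV rOne; Op OAdd rVDir rVDir rTwo;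
            Op OLt rVMore rV rN])].

(** The counter of side s of the biclique with record address x is the word at
    [rCount] + x + s, so the counter of the opposite side is at
    [rCount] + x + 1 - s. *)
Definition degree_prog : prog := block
  [:: Const rDeg 0;
      for_pointers (block
        [:: Op OAdd rX rCount rX; Op OAdd rX rX rOne; Op OSub rX rX rBit;
            Read rY rX; Op OAdd rDeg rDeg rY])].

Definition update_prog (o : binop) : prog := for_pointers (block
  [:: Op OAdd rX rCount rX; Op OAdd rX rX rBit;
      Read rY rX; Op o rY rY rOne; Write rX rY]).

Definition insert_prog : prog := block
  [:: degree_prog; Op OAdd rEdges rEdges rDeg; update_prog OAdd].

(** Deleted vertices are written from the end of the order array to its start.
    When all vertices are gone, the set that was alive at any given moment
    therefore fills an initial segment of this array. *)
Definition delete_prog : prog := block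
  [:: Op OAdd rT rDead rV; Write rT rOne; Op OSub rEdges rEdges rDeg;
      Op OSub rSize rSize rOne; Op OAdd rT rOrder rSize; Write rT rV;
      update_prog OSub].

Definition peel_prog : prog := block
  [:: Op OAdd rT rDead rV; Read rT rT;
      If rT (block [::]) (block
        [:: degree_prog; Op OMul rT rDeg rSizeN; Op OLt rT rRhs rT;
            If rT (block [::]) delete_prog])].

(** Densities are compared by cross-multiplication.  The test of [peel_prog]
    uses the values that the edge and vertex numbers have when the round
    starts, which [rRhs] and [rSizeN] keep. *)
Definition round_prog : prog := block
  [:: Op OMul rT rEdges rBestSize; Op OMul rU rBestEdges rSize;
      Op OLt rT rU rT;
      If rT (block [:: Op OAdd rBestEdges rEdges rZero;
                       Op OAdd rBestSize rSize rZero]) (block [::]);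
      Op OMul rRhs rAlpha rEdges; Op OAdd rRhs rRhs rRhs;
      Op OMul rSizeN rSize rN;
      for_vertices peel_prog].

(** The memory behind the input holds the order array (n words), the flags of
    the deleted vertices (n words) and the counters.  The counters and the
    number of edges are obtained by inserting the vertices one at a time, as
    deletions undo them later. *)
Definition peeling_prog : prog := block
  [:: Op OAdd rT rK rK; Op OAdd rT rT rT; Const rDir header_size;
      Op OAdd rDir rDir rT;
      Op OAdd rT rDir rN; Op OAdd rT rT rN; Op OSub rT rT rTwo;
      Read rU rT; Op OAdd rT rT rOne; Read rT rT;
      Op OAdd rOrder rT rU; Op OAdd rDead rOrder rN; Op OAdd rCount rDead rN;
      Const rEdges 0; for_vertices insert_prog;
      Op OAdd rSize rN rZero; Op OAdd rBestEdges rEdges rZero;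
      Op OAdd rBestSize rN rZero;
      While rSize round_prog;
      Op OAdd 0 rBestSize rZero; Op OAdd 1 rOrder rZero].

(** Words 4 and 6 are the addresses of L_0 and R_0 in the directory.  Without a
    biclique the graph has no edge, and every vertex is optimal. *)
Definition edge_prog : prog :=
  If rK
    (block [:: Const rT 4; Read rT rT; Read rT rT;
               Const rU 6; Read rU rU; Read rU rU;
               Write rZero rT; Write rOne rU; Const 0 2; Const 1 0])
    (block [:: Write rZero rZero; Const 0 1; Const 1 0]).

(** In words that can hold n * n, the fixed-point value of alpha reaches n * n
    if and only if alpha >= n. *)
Definition densest_prog : prog := block
  [:: Const rZero 0; Const rOne 1; Const rTwo 2;
      Read rN rZero; Read rK rOne; Read rAlpha rTwo;
      Op OMul rT rN rN; Op OLt rT rAlpha rT;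
      If rT peeling_prog edge_prog].

(** * Total correctness with time bounds *)

Section Logic.
Context {w : nat}.
Implicit Types (s : state) (P Q : state -> Prop) (l : seq prog).

Definition halts (p : prog) s (T : nat) Q : Prop :=
  exists s' t, [/\ exec w p s s' t, t <= T & Q s'].

Lemma halts_weaken p s T T' Q Q' :
  halts p s T Q -> T <= T' -> (forall s', Q s' -> Q' s') -> halts p s T' Q'.
Proof.
by move=> [s' [t [ex le_t Qs']]] le_T QQ'; exists s', t; split; [|lia|apply: QQ'].
Qed.

Lemma halts_le p s T T' Q : halts p s T Q -> T <= T' -> halts p s T' Q.
Proof. by move=> h le_T; apply: halts_weaken h le_T _. Qed.

Lemma halts_seq p l s T1 T2 P Q :
  halts p s T1 P -> (forall s', P s' -> halts (block l) s' T2 Q) ->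
  halts (block (p :: l)) s (T1 + T2) Q.
Proof.
move=> [s1 [t1 [ex1 le1 Ps1]]] /(_ _ Ps1)[s2 [t2 [ex2 le2 Qs2]]].
by exists s2, (t1 + t2); split; [apply: ExecSeq ex1 ex2|lia|].
Qed.

Lemma halts_nil s Q : Q (set_reg s rJunk 0) -> halts (block [::]) s 1 Q.
Proof.
move=> Qs; exists (set_reg s rJunk (0 %% 2 ^ w)), 1.
by split=> //; [apply: ExecConst | rewrite mod0n].
Qed.

Lemma halts_atom p l s s' T Q : exec w p s s' 1 ->
  halts (block l) s' T Q -> halts (block (p :: l)) s T.+1 Q.
Proof.
move=> ex h; apply: (@halts_seq p l s 1 T (eq s')) => [|_ <- //].
by exists s', 1.
Qed.

Lemma halts_const d c l s T Q : c < 2 ^ w ->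
  halts (block l) (set_reg s d c) T Q ->
  halts (block (Const d c :: l)) s T.+1 Q.
Proof.
by move=> ltc; apply: halts_atom; rewrite -{2}(modn_small ltc); apply: ExecConst.
Qed.

Lemma halts_op o d a b z l s T Q :
  eval_binop w o (reg s a) (reg s b) = z ->
  halts (block l) (set_reg s d z) T Q ->
  halts (block (Op o d a b :: l)) s T.+1 Q.
Proof. by move=> <-; apply: halts_atom; apply: ExecOp. Qed.

Lemma halts_read d a z l s T Q : memory s (reg s a) = z ->
  halts (block l) (set_reg s d z) T Q ->
  halts (block (Read d a :: l)) s T.+1 Q.
Proof. by move=> <-; apply: halts_atom; apply: ExecRead. Qed.

Lemma halts_write a b x y l s T Q : reg s a = x -> reg s b = y ->
  halts (block l) (set_mem s x y) T Q ->
  halts (block (Write a b :: l)) s T.+1 Q.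
Proof. by move=> <- <-; apply: halts_atom; apply: ExecWrite. Qed.

Lemma halts_if a p q s T Q :
  (reg s a != 0 -> halts p s T Q) -> (reg s a = 0 -> halts q s T Q) ->
  halts (If a p q) s T.+1 Q.
Proof.
case: (eqVneq (reg s a) 0) => [a0 _ /(_ a0)|a_n0 /(_ isT) + _];
  move=> [s' [t [ex le_t Qs']]]; exists s', t.+1; split=> //.
  exact: ExecIfFalse.
exact: ExecIfTrue.
Qed.

Lemma halts_while_false a p s Q : reg s a = 0 -> Q s -> halts (While a p) s 1 Q.
Proof. by move=> a0 Qs; exists s, 1; split=> //; apply: ExecWhileFalse. Qed.

Lemma halts_while_true a p s T1 T2 P Q : reg s a != 0 -> halts p s T1 P ->
  (forall s', P s' -> halts (While a p) s' T2 Q) ->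
  halts (While a p) s (T1 + T2).+1 Q.
Proof.
move=> a_n0 [s1 [t1 [ex1 le1 Ps1]]] /(_ _ Ps1)[s2 [t2 [ex2 le2 Qs2]]].
by exists s2, (t1 + t2).+1; split=> //; [apply: ExecWhileTrue ex1 ex2|lia].
Qed.

(** The loops over vertices and pointers have a number of iterations known in
    advance; the loop over the rounds is handled by the two rules above. *)
Lemma halts_while a p N (c : nat -> nat) (Inv : nat -> state -> Prop) s :
  (forall q s', q < N -> Inv q s' ->
    reg s' a != 0 /\ halts p s' (c q) (Inv q.+1)) ->
  (forall s', Inv N s' -> reg s' a = 0) ->
  Inv 0 s ->
  halts (While a p) s ((\sum_(0 <= q < N) (c q).+1).+1) (Inv N).
Proof.
move=> step stop Inv0.
suff run m q s' : q + m = N -> Inv q s' ->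
    halts (While a p) s' (\sum_(q <= i < N) (c i).+1).+1 (Inv N).
  exact: (run N 0 s (add0n N) Inv0).
elim: m q s' => [|m IH] q s' eqN Iq.
  rewrite addn0 in eqN; rewrite -eqN big_geq // in stop *.
  by apply: halts_while_false => //; apply: stop.
have lt_qN : q < N by lia.
have [a_n0 h] := step _ _ lt_qN Iq.
rewrite big_ltn // addSn -addnS; apply: halts_while_true a_n0 h _ => s1 I1.
by apply: IH I1; lia.
Qed.

End Logic.

(** * Overflow-free arithmetic, frames and loops *)

Section Eval.
Variable w : nat.

Lemma evalD x y : x + y < 2 ^ w -> eval_binop w OAdd x y = x + y.
Proof. exact: modn_small. Qed.

Lemma evalM x y : x * y < 2 ^ w -> eval_binop w OMul x y = x * y.
Proof. exact: modn_small. Qed.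

(** The machine adds 2 ^ w to stay in the natural numbers. *)
Lemma evalB x y : y <= x -> x < 2 ^ w -> eval_binop w OSub x y = x - y.
Proof.
move=> le_yx lt_x; rewrite /eval_binop -addnBAC // modnDr modn_small //.
by rewrite (leq_ltn_trans (leq_subr _ _)).
Qed.

Lemma evalLt x y : 1 < 2 ^ w -> eval_binop w OLt x y = (x < y).
Proof. by move=> lt1; rewrite /eval_binop modn_small //; case: (x < y); lia. Qed.

End Eval.

(** The frame condition of a program that only writes the scratch registers. *)
Definition agree (scratch : seq nat) s s' :=
  forall x, x \notin scratch -> reg s' x = reg s x.

Lemma agree_trans scr s1 s2 s3 : agree scr s1 s2 -> agree scr s2 s3 -> agree scr
    s1 s3.
Proof. by move=> a12 a23 x xs; rewrite a23 ?a12. Qed.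

Lemma agree_sub scr scr' s1 s2 :
  {subset scr <= scr'} -> agree scr s1 s2 -> agree scr' s1 s2.
Proof. by move=> sub a12 x xs; apply: a12; apply: contra xs; apply: sub. Qed.

(** Proves [agree] for a state obtained by explicit register assignments. *)
Ltac frame := 
  let x := fresh "x" in
  move=> x; rewrite /= /upd; do ![case: eqP => [->|_] //].

Definition pointer_scratch := [:: rT; rP; rEnd; rPMore; rX; rBit; rJunk].
Definition vertex_scratch := [:: rV; rVDir; rVMore; rJunk].

Section Loops.
Context {w : nat}.

(** The invariant is indexed by the number of pointers already treated.  It must
    not depend on the bookkeeping registers of the loop and must keep the block
    of the vertex readable. *)
Section Pointers.
Variables (body : prog) (c : nat) (l : seq (nat * bool)) (va addr : nat) (Inv :
    nat -> state -> Prop).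
Variable p0 : nat * bool.
Hypothesis va_lt : va + 1 < 2 ^ w.
Hypothesis addr_lt : addr + 2 * size l + 2 < 2 ^ w.
Hypothesis Inv_consts : forall q s, Inv q s -> reg s rOne = 1 /\ reg s rTwo = 2.
Hypothesis Inv_block : forall q s j, Inv q s -> j < size l ->
  memory s (addr + 2 * j) = biclique_addr (nth p0 l j).1 /\
  memory s (addr + 2 * j + 1) = (nth p0 l j).2.
Hypothesis Inv_stable : forall q s s',
  Inv q s -> agree pointer_scratch s s' -> memory s = memory s' -> Inv q s'.
Hypothesis body_spec : forall q s, q < size l -> Inv q s ->
  reg s rX = biclique_addr (nth p0 l q).1 -> reg s rBit = (nth p0 l q).2 ->
  halts (w := w) body s c (fun s' =>
    [/\ Inv q.+1 s', reg s' rP = reg s rP & reg s' rEnd = reg s rEnd]).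

Lemma halts_for_pointers s :
  reg s rVDir = va -> memory s va = 2 * size l -> memory s (va + 1) = addr ->
  Inv 0 s ->
  halts (w := w) (for_pointers body) s ((c + 7) * size l + 7) (Inv (size l)).
Proof.
move=> sva mva mva1 Inv0.
have [s1 s2] := Inv_consts Inv0.
have lt1 : 1 < 2 ^ w by lia.
pose J q s' := [/\ Inv q s', reg s' rP = addr + 2 * q,
  reg s' rEnd = addr + 2 * size l & reg s' rPMore = (q < size l)].
eapply halts_le.
  apply: (halts_read (z := 2 * size l)); first by rewrite sva.
  apply: (halts_op (z := va + 1)); first by rewrite /= /upd /= sva s1 evalD.
  apply: (halts_read (z := addr)) => //.
  apply: (halts_op (z := addr + 2 * size l)).
    by rewrite /= /upd /= evalD //; lia.
  apply: (halts_op (z := 0 < size l)).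
    by rewrite /= /upd /= evalLt // -[X in X < _]addn0 ltn_add2l; case: size.
  apply: (halts_seq (P := J (size l))).
    apply: (halts_while (c := fun=> c + 6)) => [q s' ltq [Iq sP sE sM]||].
    - rewrite sM ltq; split=> //.
      have [o1 o2] := Inv_consts Iq; have [b0 b1] := Inv_block Iq ltq.
      eapply halts_le.
        apply: (halts_read (z := biclique_addr (nth p0 l q).1)).
          by rewrite sP.
        apply: (halts_op (z := addr + 2 * q + 1)).
          by rewrite /= /upd /= sP o1 evalD; lia.
        apply: (halts_read (z := (nth p0 l q).2)) => //.
        apply: halts_seq.
          apply: (body_spec ltq) => //; first by apply: Inv_stable Iq _ _ => //;
              frame.
        move=> s'' [Iq1 sP1 sE1]; have [o1' o2'] := Inv_consts Iq1.
        move: sP1 sE1; rewrite /= /upd /= sP sE => sP1 sE1.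
        apply: (halts_op (z := addr + 2 * q.+1)).
          by rewrite sP1 o2' evalD; lia.
        apply: (halts_op (z := q.+1 < size l)).
          by rewrite /= /upd /= sE1 evalLt //; congr nat_of_bool; lia.
        apply: halts_nil; split=> //.
        by apply: Inv_stable Iq1 _ _ => //; frame.
      by rewrite !addnS addn0.
    - by move=> s' [_ _ _ ->]; rewrite ltnn.
    - split=> //; last by rewrite /= /upd /= muln0 addn0.
      by apply: Inv_stable Inv0 _ _ => //; frame.
  move=> s' [Is _ _ _]; apply: halts_nil.
  by apply: Inv_stable Is _ _ => //; frame.
by rewrite sum_nat_const_nat; lia.
Qed.

End Pointers.

Section Vertices.
Variables (n vd : nat) (body : prog) (c : nat -> nat) (Inv : nat -> state -> Prop).
Hypothesis vd_lt : vd + 2 * n < 2 ^ w.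
Hypothesis n_lt : n.+1 < 2 ^ w.
Hypothesis Inv_consts : forall q s, Inv q s ->
  [/\ reg s rZero = 0, reg s rOne = 1, reg s rTwo = 2, reg s rN = n &
      reg s rDir = vd].
Hypothesis Inv_stable : forall q s s',
  Inv q s -> agree vertex_scratch s s' -> memory s = memory s' -> Inv q s'.
Hypothesis body_spec : forall q s, q < n -> Inv q s ->
  reg s rV = q -> reg s rVDir = vd + 2 * q ->
  halts (w := w) body s (c q) (fun s' =>
    [/\ Inv q.+1 s', reg s' rV = reg s rV & reg s' rVDir = reg s rVDir]).

Lemma halts_for_vertices s : Inv 0 s ->
  halts (w := w) (for_vertices body) s (\sum_(q < n) c q + 5 * n + 5) (Inv n).
Proof.
move=> Inv0; have [s0 s1 s2 sN sD] := Inv_consts Inv0.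
have lt1 : 1 < 2 ^ w by lia.
pose J q s' := [/\ Inv q s', reg s' rV = q, reg s' rVDir = vd + 2 * q & reg s'
    rVMore = (q < n)].
eapply halts_le.
  apply: halts_const; first by lia.
  apply: (halts_op (z := vd)); first by rewrite /= /upd /= sD s0 evalD; lia.
  apply: (halts_op (z := 0 < n)); first by rewrite /= /upd /= sN evalLt.
  apply: (halts_seq (P := J n)).
    apply: (halts_while (c := fun q => c q + 4)) => [q s' ltq [Iq sV sVD sM]||].
    - rewrite sM ltq; split=> //; eapply halts_le.
        apply: halts_seq; first exact: (body_spec ltq Iq sV sVD).
        move=> s'' [Iq1 sV1 sVD1]; rewrite sV in sV1; rewrite sVD in sVD1.
        have [o0 o1 o2 oN oD] := Inv_consts Iq1.
        apply: (halts_op (z := q.+1)).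
          by rewrite sV1 o1 evalD; lia.
        apply: (halts_op (z := vd + 2 * q.+1)).
          by rewrite /= /upd /= sVD1 o2 evalD; lia.
        apply: (halts_op (z := q.+1 < n)).
          by rewrite /= /upd /= oN evalLt.
        apply: halts_nil; split=> //.
        by apply: Inv_stable Iq1 _ _ => //; frame.
      by [].
    - by move=> s' [_ _ _ ->]; rewrite ltnn.
    - split=> //; last by rewrite /= /upd /= muln0 addn0.
      by apply: Inv_stable Inv0 _ _ => //; frame.
  move=> s' [Is _ _ _]; apply: halts_nil.
  by apply: Inv_stable Is _ _ => //; frame.
rewrite big_mkord (eq_bigr (fun q : 'I_n => c q + 5)) => [|q _]; last by lia.
by rewrite big_split sum_nat_const card_ord /=; lia.
Qed.

End Vertices.
End Loops.

(** * Correctness and running time of the peeling program *)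

(** The input enters through the directory entries and the blocks of the
    vertices only: [inp] is its content, [W] its length and [baddr v] the
    address of the block of v. *)
Section Machine.
Context {n : nat} (G : sgraph n) (B : seq (vpair n)) (r : cb_rep n).
Variables (w A W : nat) (inp : nat -> nat) (baddr : 'I_n -> nat).
Let k := size B.
Let vdir := header_size + 4 * k.
Let order := W.
Let dead := W + n.
Let count := W + n + n.
Let no_pointer := (0, false).

Hypothesis partB : biclique_partition G B.
Hypothesis repB : cb_represents B r.
Hypothesis input_dir : forall v : 'I_n,
  inp (vdir + 2 * v) = 2 * size (cb_pointers r v) /\
  inp (vdir + 2 * v + 1) = baddr v.
Hypothesis input_block : forall (v : 'I_n) j, j < size (cb_pointers r v) ->
  inp (baddr v + 2 * j) = biclique_addr (nth no_pointer (cb_pointers r v) j).1 /\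
  inp (baddr v + 2 * j + 1) = (nth no_pointer (cb_pointers r v) j).2.
Hypothesis block_le : forall v : 'I_n, baddr v + 2 * size (cb_pointers r v) <= W.
Hypothesis vdir_le : vdir + 2 * n <= W.
Hypothesis space : W + n + n + 4 * k + 10 < 2 ^ w.
Notation halts := (halts (w := w)).

Definition params s := 
  [seq reg s x | x <- [:: rZero; rOne; rTwo; rN; rAlpha; rDir; rOrder; rDead; rCount]]
  = [:: 0; 1; 2; n; A; vdir; order; dead; count].

Definition intact s := forall a, a < W -> memory s a = inp a.

Definition loc (p : nat * bool) := count + biclique_addr p.1 + p.2.

Definition counts s (S : {set 'I_n}) := forall p,
  p.1 < k -> memory s (loc p) = side_count B S p.

(** A biclique record has four words, of which only the first two offsets serve
    as counters. *)
Lemma loc_inj : injective loc.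
Proof.
move=> [i b] [j c]; rewrite /loc /biclique_addr /= => E.
have := leq_b1 b; have := leq_b1 c => le_c le_b.
have [-> bc] : i = j /\ (b = c :> nat) by lia.
by move: bc {E le_c le_b}; case: b; case: c.
Qed.

Lemma mem_pointers v p : p.1 < k -> (p \in cb_pointers r v) = (v \in side B p).
Proof. by case: repB => _ _ _; case: p => i b /(_ v i b) -> /= ->. Qed.

Lemma pointer_lt v p : p \in cb_pointers r v -> p.1 < k.
Proof. by case: repB => _ _ _; case: p => i b /(_ v i b) -> /andP[]. Qed.

Definition degree_scratch := rY :: rDeg :: pointer_scratch.

Lemma degree_prog_halts s S (v : 'I_n) :
  params s -> intact s -> counts s S -> reg s rVDir = vdir + 2 * v ->
  halts degree_prog s (13 * size (cb_pointers r v) + 9) (fun s' =>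
    [/\ agree degree_scratch s s', memory s' = memory s
      & reg s' rDeg = degree_in G S v]).
Proof.
move=> par int cnt sV; set l := cb_pointers r v.
have ltn := ltn_ord v; have le_b := block_le v; rewrite -/l in le_b.
have [dir0 dir1] := input_dir v.
pose D q := \sum_(p <- take q l) side_count B S (opposite p).
have D_le q : D q <= n.
  apply: leq_trans (degree_in_le G S v).
  by rewrite (degree_pointers partB repB) -/l -[X in _ <= \sum_(_ <- X)
      _](cat_take_drop q) big_cat leq_addr.
pose Inv q s' := [/\ agree degree_scratch s s', memory s' = memory s & reg s'
    rDeg = D q].
eapply halts_le.
  apply: halts_const; first by lia.
  apply: halts_seq.
    apply: (@halts_for_pointers w _ 6 l (vdir + 2 * v) (baddr v) Inv no_pointer).
    - by lia.
    - by lia.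
    - by move=> q s' [ag _ _]; rewrite !ag //; case: par.
    - move=> q s' j [_ -> _] ltj; have [<- <-] := input_block ltj.
      by rewrite !int //; lia.
    - move=> q s1 s2 [ag m1 d] ag2 m2; split; last by rewrite ag2.
        by apply: agree_trans ag (agree_sub _ ag2) => x; rewrite !inE => ->;
            rewrite !orbT.
      by rewrite -m2.
    - move=> q s' ltq [ag m d] sX sB.
      have [o1 c0] : reg s' rOne = 1 /\ reg s' rCount = count.
        by rewrite !ag //; case: par.
      set p := nth no_pointer l q in sX sB.
      have ltp : p.1 < k by apply: pointer_lt (mem_nth no_pointer ltq).
      have ltp' : biclique_addr p.1 <= 4 * k by rewrite /biclique_addr
          /header_size; lia.
      have le1 : p.2 <= 1 := leq_b1 _.
      have neg : ~~ p.2 = 1 - p.2 :> nat by case: (p.2).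
      have DS : D q.+1 = D q + side_count B S (opposite p).
        by rewrite /D (take_nth no_pointer) // -cats1 big_cat big_seq1.
      have Dq1 := D_le q.+1.
      eapply halts_le.
        apply: (halts_op (z := count + biclique_addr p.1)).
          by rewrite sX c0 evalD; rewrite /count; lia.
        apply: (halts_op (z := count + biclique_addr p.1 + 1)).
          by rewrite /= /upd /= o1 evalD; rewrite /count; lia.
        apply: (halts_op (z := loc (opposite p))).
          by rewrite /= /upd /= sB evalB; rewrite /loc /count /opposite /= ?neg; lia.
        apply: (halts_read (z := side_count B S (opposite p))).
          by rewrite /= /upd /= m cnt.
        apply: (halts_op (z := D q.+1)).
          by rewrite /= /upd /= d DS evalD // -DS; lia.
        apply: halts_nil; split=> //; split=> //.
        by apply: agree_trans ag _; frame.
      by [].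
    - by rewrite /= /upd /= sV.
    - by rewrite /= int ?dir0 //; lia.
    - by rewrite /= int ?dir1 //; lia.
    - split=> //; first by frame.
      by rewrite /D take0 big_nil.
  move=> s' [ag m d]; apply: halts_nil; split=> //.
    by apply: agree_trans ag _; frame.
  by rewrite /= /upd /= d /D take_size (degree_pointers partB repB).
lia.
Qed.

Definition update_scratch := rY :: pointer_scratch.

(** A pointer occurs once in its list, so each counter changes at most once. *)
Lemma update_prog_halts s (v : 'I_n) o (f : nat -> nat) :
  params s -> intact s -> reg s rVDir = vdir + 2 * v ->
  (forall p, p \in cb_pointers r v ->
    eval_binop w o (memory s (loc p)) 1 = f (memory s (loc p))) ->
  halts (update_prog o) s (13 * size (cb_pointers r v) + 7) (fun s' =>
    agree update_scratch s s' /\ forall a, memory s' a =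
      if a \in map loc (cb_pointers r v) then f (memory s a) else memory s a).
Proof.
move=> par int sV evalf; set l := cb_pointers r v.
have ltn := ltn_ord v; have le_b := block_le v; rewrite -/l in le_b.
have [dir0 dir1] := input_dir v.
have uniq_l : uniq (map loc l).
  by rewrite (map_inj_uniq loc_inj) /l; have [_ _ u _] := repB; apply: u.
pose Inv q s' := agree update_scratch s s' /\ forall a, memory s' a =
  if a \in map loc (take q l) then f (memory s a) else memory s a.
have loc_ge p : W <= loc p by rewrite /loc /count; lia.
have Inv_low q s' a : Inv q s' -> a < W -> memory s' a = inp a.
  case=> _ -> lta; rewrite ifN ?int //; apply/mapP=> -[p _ E].
  by have := loc_ge p; lia.
apply: (halts_weaken (T := 13 * size l + 7) (Q := Inv (size l))) => //; last first.
  by move=> s'; rewrite /Inv take_size.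
  apply: (@halts_for_pointers w _ 6 l (vdir + 2 * v) (baddr v) Inv no_pointer).
  - by lia.
  - by lia.
  - by move=> q s' [ag _]; rewrite !ag //; case: par.
  - move=> q s' j Iq ltj; have [<- <-] := input_block ltj.
    by rewrite !(Inv_low _ _ _ Iq) //; lia.
  - move=> q s1 s2 [ag m1] ag2 m2; split; last by rewrite -m2.
    by apply: agree_trans ag (agree_sub _ ag2) => x; rewrite !inE => ->; rewrite
        !orbT.
  - move=> q s' ltq [ag m] sX sB.
    have [o1 c0] : reg s' rOne = 1 /\ reg s' rCount = count.
      by rewrite !ag //; case: par.
    set p := nth no_pointer l q in sX sB.
    have lp : p \in l := mem_nth no_pointer ltq.
    have ltp : p.1 < k := pointer_lt lp.
    have ltp' : biclique_addr p.1 <= 4 * k by rewrite /biclique_addr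
        /header_size; lia.
    have le1 : p.2 <= 1 := leq_b1 _.
    have takeS : take q.+1 l = rcons (take q l) p by rewrite (take_nth no_pointer).
    have m_p : memory s' (loc p) = memory s (loc p).
      rewrite m ifN //; have := uniq_l; rewrite -{1}(cat_take_drop q.+1 l) takeS.
      by rewrite map_cat map_rcons cat_uniq rcons_uniq => /andP[/andP[]].
    eapply halts_le.
      apply: (halts_op (z := count + biclique_addr p.1)).
        by rewrite sX c0 evalD; rewrite /count; lia.
      apply: (halts_op (z := loc p)).
        by rewrite /= /upd /= sB evalD; rewrite /loc /count; lia.
      apply: (halts_read (z := memory s (loc p))).
        by rewrite /= /upd /= m_p.
      apply: (halts_op (z := f (memory s (loc p)))).
        by rewrite /= /upd /= o1 evalf.
      apply: (halts_write (x := loc p) (y := f (memory s (loc p)))) => //.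
      apply: halts_nil; split=> //; split=> [|a].
        by apply: agree_trans ag _; frame.
      rewrite takeS map_rcons mem_rcons inE /= /upd m.
      by case: eqP => [->|].
    by [].
  - by rewrite sV.
  - by rewrite int ?dir0 //; lia.
  - by rewrite int ?dir1 //; lia.
  - by split=> [//|a]; rewrite take0.
Qed.

Hypothesis n_gt0 : 0 < n.
Hypothesis A_lt : A < n * n.
Hypothesis word_big : 2 * (n * n * (n * n)) < 2 ^ w.

Definition param_regs :=
  [:: rZero; rOne; rTwo; rN; rAlpha; rDir; rOrder; rDead; rCount].

Lemma params_agree scr s s' : all (fun x => x \notin scr) param_regs ->
  agree scr s s' -> params s -> params s'.
Proof.
move=> /allP dis ag; rewrite /params -/param_regs => <-.
by apply/eq_in_map => x /dis; apply: ag.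
Qed.

Definition alive (rs : seq 'I_n) : {set 'I_n} := [set v | v \notin rs].

Lemma card_alive rs : uniq rs -> #|alive rs| = n - size rs.
Proof.
move=> /card_uniqP card_rs; have := cardC (mem rs); rewrite card_ord card_rs.
move=> E; rewrite -[X in _ = X - _]E addKn.
by apply: eq_card => v; rewrite inE.
Qed.

Lemma alive_cons v rs : alive (v :: rs) = alive rs :\ v.
Proof. by apply/setP=> u; rewrite !inE negb_or. Qed.

(** The list rs holds the deleted vertices, the most recent one first. *)
Record encodes s rs : Prop := Encodes {
  enc_params : params s;
  enc_intact : intact s;
  enc_counts : counts s (alive rs);
  enc_dead : forall v : 'I_n, memory s (dead + v) = (v \in rs);
  enc_order : forall j, j < size rs ->
    memory s (order + (n - size rs) + j) = nth 0 (map val rs) j;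
  enc_uniq : uniq rs;
  enc_edges : reg s rEdges = num_edges G (alive rs);
  enc_size : reg s rSize = n - size rs }.

Lemma encodes_agree scr s s' rs :
  all (fun x => x \notin scr) (rEdges :: rSize :: param_regs) ->
  agree scr s s' -> memory s' = memory s -> encodes s rs -> encodes s' rs.
Proof.
move=> /= /and3P[Edis Sdis Pdis] ag m [par int cnt dd od u e z].
split=> //; first exact: params_agree ag par.
- by move=> a; rewrite m; apply: int.
- by move=> p; rewrite m; apply: cnt.
- by move=> v; rewrite m.
- by move=> j; rewrite m; apply: od.
- by rewrite ag.
- by rewrite ag.
Qed.

Lemma counts_update (f : nat -> nat) s s' (v : 'I_n) (S S' : {set 'I_n}) :
  counts s S ->
  (forall a, memory s' a = if a \in map loc (cb_pointers r v)
                           then f (memory s a) else memory s a) ->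
  (forall p, side_count B S' p =
     if v \in side B p then f (side_count B S p) else side_count B S p) ->
  counts s' S'.
Proof.
move=> cnt m card p ltp; rewrite m (mem_map loc_inj) mem_pointers // card.
by rewrite cnt.
Qed.

Definition delete_scratch := rT :: rEdges :: rSize :: update_scratch.

Lemma delete_prog_halts s rs (v : 'I_n) :
  encodes s rs -> v \notin rs -> reg s rV = v -> reg s rVDir = vdir + 2 * v ->
  reg s rDeg = degree_in G (alive rs) v ->
  halts delete_prog s (13 * size (cb_pointers r v) + 14) (fun s' =>
    encodes s' (v :: rs) /\ agree delete_scratch s s').
Proof.
move=> [par int cnt dd od u e z] v_rs sV sVD sDeg; have ltv := ltn_ord v.
have [s1 sO sD] : [/\ reg s rOne = 1, reg s rOrder = order & reg s rDead = dead].
  by case: par.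
have vS : v \in alive rs by rewrite inE.
have size_lt : size rs < n.
  have : 0 < #|alive rs| by apply/card_gt0P; exists v.
  by rewrite card_alive // subn_gt0.
have edgesE := num_edges_del G vS; have e_le := num_edges_le G (alive rs).
have nn_le : n * n <= n * n * (n * n) by rewrite leq_pmulr ?muln_gt0 ?n_gt0.
pose m1 := upd (memory s) (dead + v) 1.
pose m2 := upd m1 (order + (n - size rs).-1) v.
have low a : a < W -> m2 a = memory s a.
  by move=> lta; rewrite /m2 /m1 /upd !ifN // /order /dead; apply/eqP; lia.
have high a : count <= a -> m2 a = memory s a.
  by move=> lea; rewrite /m2 /m1 /upd !ifN // /order /dead; apply/eqP; move: lea;
      rewrite /count; lia.
have loc_high p : count <= loc p by rewrite /loc; lia.
eapply halts_le.
  apply: (halts_op (z := dead + v)).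
    by rewrite sD sV evalD // /dead; lia.
  apply: (halts_write (x := dead + v) (y := 1)); rewrite // /= /upd //=.
  apply: (halts_op (z := num_edges G (alive rs :\ v))).
    by rewrite /= /upd /= e sDeg evalB; lia.
  apply: (halts_op (z := (n - size rs).-1)).
    by rewrite /= /upd /= z s1 evalB; lia.
  apply: (halts_op (z := order + (n - size rs).-1)).
    by rewrite /= /upd /= sO evalD // /order; lia.
  apply: (halts_write (x := order + (n - size rs).-1) (y := v)); rewrite // /=
      /upd //=.
  apply: halts_seq.
    apply: (@update_prog_halts _ v OSub predn) => //.
    - by move=> a lta; rewrite -int // -low.
    - move=> p pv; rewrite /= -!/(m2 _) high //; have ltp := pointer_lt pv.
      rewrite cnt // evalB ?subn1 //.
        rewrite /side_count; apply/card_gt0P; exists v; rewrite !inE v_rs andbT.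
        by rewrite -mem_pointers.
      by apply: leq_ltn_trans (max_card _) _; rewrite card_ord; lia.
  move=> s' [ag m]; apply: halts_nil.
  have m' a : a < count -> memory s' a = m2 a.
    by move=> lta; rewrite m ifN //; apply/mapP=> -[p _ E]; have := loc_high p; lia.
  have ag' : agree delete_scratch s (set_reg s' rJunk 0).
    move=> x xs; rewrite /= /upd; case: eqP xs => [->//|_ xs].
    rewrite ag; last by apply: contra xs; rewrite !inE => ->; rewrite !orbT.
    by move: xs; rewrite /= /upd; do ![case: eqP => [->|_] //].
  split=> //; split=> //=.
  - by apply: params_agree ag' par.
  - by move=> a lta; rewrite /= m' ?low ?int //; rewrite /count; lia.
  - rewrite alive_cons; apply: (counts_update (f := predn) (v := v) (S := alive
      rs)) (m) _.
      by move=> p ltp; rewrite /= -/(m2 _) high // cnt.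
    move=> p; rewrite /side_count setIDA [in RHS](cardsD1 v (_ :&: _)) inE vS andbT.
    by case: (v \in _).
  - move=> x; rewrite m' /dead /count; last by have := ltn_ord x; lia.
    rewrite /m2 /m1 /upd ifN; last by rewrite /order /dead; apply/eqP; lia.
    rewrite /dead eqn_add2l inE -val_eqE /=; case: eqP => // _; exact: dd.
  - case=> [|j] ltj; rewrite m' /count /order; try lia.
      by rewrite /m2 /upd addn0 subnS eqxx.
    rewrite /m2 /m1 /upd !ifN; try by rewrite /dead /order; apply/eqP; lia.
    by rewrite [RHS]/= -od //; congr (memory s _); rewrite /order; lia.
  - by rewrite v_rs.
  - by rewrite /upd /= ag // alive_cons.
  - by rewrite /upd /= ag // /= /upd /=; lia.
lia.
Qed.

Definition peel_scratch := rT :: rEdges :: rSize :: degree_scratch.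
Definition sweep_scratch := vertex_scratch ++ peel_scratch.

Definition light (t z : nat) rs (v : 'I_n) :=
  (v \notin rs) && (degree_in G (alive rs) v * z <= t).

Lemma peel_prog_halts s rs (v : 'I_n) t z :
  encodes s rs -> reg s rV = v -> reg s rVDir = vdir + 2 * v ->
  reg s rRhs = t -> reg s rSizeN = z -> n * z < 2 ^ w ->
  halts peel_prog s (26 * size (cb_pointers r v) + 40) (fun s' =>
    agree peel_scratch s s' /\
    encodes s' (if light t z rs v then v :: rs else rs)).
Proof.
move=> enc sV sVD sR sZ lt_nz; have ltv := ltn_ord v.
have [par int cnt dd _ _ _ _] := enc.
have sD : reg s rDead = dead by case: par.
have deg_le := degree_in_le G (alive rs) v.
have dz_lt : degree_in G (alive rs) v * z < 2 ^ w.
  by apply: leq_ltn_trans lt_nz; rewrite leq_mul2r deg_le orbT.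
pose R s' := agree peel_scratch s s' /\
  encodes s' (if light t z rs v then v :: rs else rs).
eapply halts_le.
  apply: (halts_op (z := dead + v)).
    by rewrite sD sV evalD // /dead; lia.
  apply: (halts_read (z := v \in rs)); first by rewrite /= /upd /= dd.
  apply: halts_seq.
    apply: (halts_if (T := 26 * size (cb_pointers r v) + 33) (Q := R)); rewrite
        /= {1}/upd /=.
      case: (boolP (v \in rs)) => // v_rs _; eapply halts_le.
        apply: halts_nil; rewrite /R /light v_rs /=; split; first by frame.
        by apply: (encodes_agree (scr := [:: rT; rJunk])) enc => //; frame.
      by lia.
    case: (boolP (v \in rs)) => // v_rs _; eapply halts_le.
      apply: halts_seq.
        by apply: (@degree_prog_halts _ (alive rs) v).
      move=> s1 [ag1 m1 d1]; rewrite /= in m1.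
      have reg1 x : x \notin rT :: rJunk :: degree_scratch -> reg s1 x = reg s x.
        move=> xs; rewrite ag1; first by move: xs; rewrite /= /upd; do ![case:
            eqP => [->|_] //].
        by apply: contra xs; rewrite !inE => ->; rewrite !orbT.
      have enc1 : encodes s1 rs by apply: (encodes_agree (scr := rT :: rJunk ::
          degree_scratch)) enc.
      apply: (halts_op (z := degree_in G (alive rs) v * z)).
        by rewrite d1 reg1 // sZ evalM.
      apply: (halts_op (z := t < degree_in G (alive rs) v * z)).
        by rewrite /= /upd /= reg1 // sR evalLt; lia.
      apply: halts_seq.
        apply: (halts_if (T := 13 * size (cb_pointers r v) + 14) (Q := R));
          rewrite /= {1}/upd /=.
          case: ltnP => // lt_t _; eapply halts_le.
            apply: halts_nil; rewrite /R /light v_rs leqNgt lt_t /=; split.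
              by move=> x xs; rewrite -reg1 //; [move: x xs; frame|apply: contra
                  xs; rewrite !inE => /orP[->//|/orP[]->]; rewrite !orbT].
            by apply: (encodes_agree (scr := [:: rT; rJunk])) enc1 => //; frame.
          by lia.
        case: ltnP => // le_t _.
        apply: (halts_weaken (delete_prog_halts (s := set_reg _ _ _) (rs := rs)
            (v := v) _ _ _ _ _)) => //.
        - by apply: (encodes_agree (scr := [:: rT; rJunk])) enc1 => //; frame.
        - by rewrite /= /upd /= reg1.
        - by rewrite /= /upd /= reg1.
        move=> s2 [enc2 ag2]; rewrite /R /light v_rs le_t; split=> // x xs.
        rewrite ag2; last by apply: contra xs; rewrite !inE; do ![case: eqP => //= _].
        rewrite -reg1; first by move: x xs; frame.
        by apply: contra xs; rewrite !inE; do ![case: eqP => //= _].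
      move=> s2 [ag2 enc2]; apply: halts_nil; split.
        by apply: agree_trans ag2 _; frame.
      by apply: (encodes_agree (scr := [:: rJunk])) enc2 => //; frame.
    lia.
  move=> s2 [ag2 enc2]; apply: halts_nil; split.
    by apply: agree_trans ag2 _; frame.
  by apply: (encodes_agree (scr := [:: rJunk])) enc2 => //; frame.
lia.
Qed.

Definition pointer_count q :=
  nth 0 [seq size (cb_pointers r v) | v <- enum 'I_n] q.

Lemma pointer_count_ord (v : 'I_n) : pointer_count v = size (cb_pointers r v).
Proof. by rewrite /pointer_count (nth_map v) ?size_enum_ord // nth_ord_enum. Qed.

Lemma sum_pointer_count a b :
  \sum_(q < n) (a * pointer_count q + b) = a * weight B + b * n.
Proof.
rewrite big_split sum_nat_const card_ord /= [n * b]mulnC; congr (_ + _).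
rewrite -(sum_size_pointers repB) big_distrr.
by apply: eq_bigr => v _; rewrite pointer_count_ord.
Qed.

Lemma alive_sub rs rs' : {subset rs <= rs'} -> alive rs' \subset alive rs.
Proof.
by move=> sub; apply/subsetP=> v; rewrite !inE; apply: contra; apply: sub.
Qed.

(** The property P is any consequence of having deleted light vertices only.
    A survivor is heavy in the graph at the time of its test, hence also in the
    larger graph at the start of the round. *)
Lemma sweep_halts s rs0 t z (P : seq 'I_n -> Prop) :
  encodes s rs0 -> reg s rRhs = t -> reg s rSizeN = z -> n * z < 2 ^ w ->
  (forall rs v, P rs -> light t z rs v -> P (v :: rs)) -> P rs0 ->
  halts (for_vertices peel_prog) s (26 * weight B + 45 * n + 5) (fun s' =>
    agree sweep_scratch s s' /\ exists rs, [/\ encodes s' rs, P rs &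
      forall v, v \notin rs -> t < degree_in G (alive rs0) v * z]).
Proof.
move=> enc0 sR sZ lt_nz P_step P0.
pose Inv q s' := agree sweep_scratch s s' /\ exists rs,
  [/\ encodes s' rs, P rs, {subset rs0 <= rs} & forall v : 'I_n, v < q ->
      v \notin rs -> t < degree_in G (alive rs0) v * z].
apply: (halts_weaken (T := \sum_(q < n) (26 * pointer_count q + 40) + 5 * n + 5)
   (Q := Inv n)); first last.
- move=> s' [ag [rs [enc Prs _ heavy]]]; split=> //; exists rs; split=> // v.
  by apply: heavy.
- by rewrite sum_pointer_count; lia.
apply: (@halts_for_vertices w n vdir peel_prog (fun q => 26 * pointer_count q +
    40) Inv).
- by lia.
- by lia.
- by move=> q s' [ag [rs [enc _ _ _]]]; have := enc_params enc; case.
- move=> q s1 s2 [ag [rs [enc Prs sub heavy]]] ag2 m2; split.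
    apply: agree_trans ag (agree_sub _ ag2) => x.
    by rewrite mem_cat => ->.
  exists rs; split=> //; apply: (encodes_agree _ ag2) enc => //; exact/esym.
- move=> q s' ltq [ag [rs [enc Prs sub heavy]]] sV sVD.
  pose v := Ordinal ltq.
  apply: (halts_weaken (peel_prog_halts (v := v) (t := t) (z := z) enc sV sVD _ _
      lt_nz)).
  + by rewrite ag.
  + by rewrite ag.
  + by rewrite -pointer_count_ord.
  move=> s'' [ag2 enc2]; split; [split|by rewrite ag2..].
    apply: agree_trans ag (agree_sub _ ag2) => x.
    by rewrite mem_cat => ->; rewrite orbT.
  have old (u : 'I_n) : u < q.+1 -> u \notin rs -> t < degree_in G (alive rs0) u
      * z \/ u = v.
    rewrite ltnS leq_eqVlt => /orP[/eqP E _|ltu u_rs]; first by right; apply: val_inj.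
    by left; apply: heavy.
  case lv: (light t z rs v) enc2 => enc2.
    exists (v :: rs); split=> //; first exact: P_step.
      by move=> x x0; rewrite inE sub ?orbT.
    by move=> u ltu; rewrite inE negb_or => /andP[uv /(old _ ltu)[//|E]]; rewrite
        E eqxx in uv.
  exists rs; split=> // u ltu u_rs; case: (old _ ltu u_rs) => // E.
  rewrite E in u_rs *; move: lv; rewrite /light u_rs /= => /negbT; rewrite
      -ltnNge => lt_t.
  by apply: leq_trans lt_t _; rewrite leq_mul2r degree_inS ?orbT ?alive_sub.
- split; last by exists rs0; split=> // v; rewrite ltn0.
  by move=> x.
Qed.

Lemma round_prog_halts s rs eb zb (P : seq 'I_n -> Prop) :
  let e := num_edges G (alive rs) in
  let z := n - size rs in
  let better := eb * z < e * zb in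
  let eb' := if better then e else eb in
  let zb' := if better then z else zb in
  encodes s rs -> reg s rBestEdges = eb -> reg s rBestSize = zb ->
  eb <= n * n -> zb <= n ->
  (forall rs' v, P rs' -> light (2 * (A * e)) (z * n) rs' v -> P (v :: rs')) ->
  P rs ->
  halts round_prog s (26 * weight B + 45 * n + 20) (fun s' =>
    [/\ reg s' rBestEdges = eb', reg s' rBestSize = zb' & exists rs',
      [/\ encodes s' rs', P rs' &
      forall v, v \notin rs' ->
        2 * (A * e) < degree_in G (alive rs) v * (z * n)]]).
Proof.
move=> e z better eb' zb' enc sE sZ le_eb le_zb P_step Prs.
have [par _ _ _ _ _ rE rZ] := enc.
have [s0 sN sA] : [/\ reg s rZero = 0, reg s rN = n & reg s rAlpha = A].
  by case: par.
have le_e : e <= n * n := num_edges_le G _.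
have le_z : z <= n := leq_subr _ _.
have n4 a b : a <= n * n -> b <= n * n -> 2 * (a * b) < 2 ^ w.
  by move=> le_a le_b; apply: leq_ltn_trans word_big; rewrite leq_mul2l leq_mul.
have le_nn a : a <= n -> a <= n * n.
  by move=> le_a; apply: leq_trans le_a _; rewrite leq_pmull.
have b1 := n4 _ _ le_e (le_nn _ le_zb); have b2 := n4 _ _ le_eb (le_nn _ le_z).
have b3 := n4 _ _ (ltnW A_lt) le_e.
have b4 : 2 * (n * (z * n)) < 2 ^ w.
  by apply: n4; [apply: le_nn|rewrite leq_mul2r le_z orbT].
have b5 : z * n < 2 ^ w by apply: leq_ltn_trans b4; rewrite mulnA leq_pmull //
    muln_gt0.
have b6 : 2 * (e * 1) < 2 ^ w by apply: n4; rewrite // muln_gt0 n_gt0.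
pose scr := [:: rT; rU; rBestEdges; rBestSize; rRhs; rSizeN; rJunk].
pose Best s' := [/\ agree scr s s', memory s' = memory s,
  reg s' rBestEdges = eb' & reg s' rBestSize = zb'].
eapply halts_le.
  apply: (halts_op (z := e * zb)); first by rewrite rE sZ evalM // -/e; lia.
  apply: (halts_op (z := eb * z)).
    by rewrite /= /upd /= rZ sE evalM // -/z; lia.
  apply: (halts_op (z := better)).
    by rewrite /= /upd /= evalLt; lia.
  apply: (halts_seq (P := Best)).
    apply: (halts_if (T := 3)); rewrite /= {1}/upd /= /Best /eb' /zb' /better;
        case: ifP => // _ _.
      apply: (halts_op (z := e)).
        by rewrite /= /upd /= rE s0 evalD // -/e addn0; lia.
      apply: (halts_op (z := z)).
        by rewrite /= /upd /= rZ s0 evalD // -/z addn0; lia.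
      by apply: halts_nil; split=> //; frame.
    eapply halts_le; first by apply: halts_nil; split=> //; frame.
    by [].
  move=> s1 [ag1 m1 sE1 sZ1].
  have reg1 x : x \notin scr -> reg s1 x = reg s x := ag1 x.
  apply: (halts_op (z := A * e)).
    by rewrite !reg1 // sA rE evalM // -/e; lia.
  apply: (halts_op (z := 2 * (A * e))).
    by rewrite /= /upd /= evalD; lia.
  apply: (halts_op (z := z * n)).
    by rewrite /= /upd /= !reg1 // rZ sN evalM.
  apply: halts_seq.
    apply: (@sweep_halts _ rs (2 * (A * e)) (z * n) P) => //.
      by apply: (encodes_agree (scr := scr)) enc => //; move=> x xs; rewrite
          -reg1 //; move: x xs; frame.
    by lia.
  move=> s2 [ag2 [rs' [enc2 Prs' heavy]]]; apply: halts_nil.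
  split; [by rewrite /= /upd /= ag2..|].
  exists rs'; split=> //.
  by apply: (encodes_agree (scr := [:: rJunk])) enc2 => //; frame.
lia.
Qed.

(** With D = 2 (A / n) (eb / zb), this is the inequality
    e(T) <= e(T cap S) + D |T - S| multiplied by n * zb. *)
Definition covers rs eb zb := forall T : {set 'I_n},
  num_edges G T * (n * zb)
  <= num_edges G (T :&: alive rs) * (n * zb) + 2 * (A * eb) * #|T :\: alive rs|.

(** A light vertex has degree at most 2 (A / n) (e / z), which the density
    eb / zb of a better set only increases. *)
Lemma covers_light rs v e z eb zb : 0 < z -> e * zb <= eb * z ->
  light (2 * (A * e)) (z * n) rs v -> covers rs eb zb -> covers (v :: rs) eb zb.
Proof.
move=> z_gt0 le_e /andP[v_rs le_d] cov T; have vS : v \in alive rs by rewrite inE.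
have := num_edges_setI_del G T vS; rewrite alive_cons card_setD_del //.
set d := degree_in _ _ _ in le_d * => le_T.
have le_dz : d * (n * zb) <= 2 * (A * eb).
  rewrite -(leq_pmul2r z_gt0); apply: (@leq_trans (2 * (A * e) * zb)); last by nia.
  by apply: leq_trans (leq_mul le_d (leqnn zb)); lia.
apply: leq_trans (cov T) _; move: le_T le_dz.
move: (num_edges _ _) (num_edges _ _) #|_| (n * zb) (2 * (A * eb)) => x y m q c.
by case: (v \in T) => le_x le_dq; nia.
Qed.

Lemma covers_better rs e z eb zb : 0 < zb -> eb * z <= e * zb ->
  covers rs eb zb -> covers rs e z.
Proof.
move=> zb_gt0 le_e cov T; rewrite -(leq_pmul2r zb_gt0).
have := leq_mul (cov T) (leqnn z); set x := num_edges _ _; set y := num_edges _ _.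
set m := #|_| => le_x; apply: (@leq_trans (x * (n * zb) * z)); first by lia.
apply: leq_trans le_x _.
suff : A * m * (eb * z) <= A * m * (e * zb) by lia.
by rewrite leq_mul2l le_e orbT.
Qed.

(** Add up the lower bounds on the degrees of the survivors and compare with the
    handshake identity for the graph at the start of the round. *)
Lemma heavy_shrink rs rs' : {subset rs <= rs'} -> uniq rs -> uniq rs' ->
  size rs < n ->
  (forall v, v \notin rs' -> 2 * (A * num_edges G (alive rs))
     < degree_in G (alive rs) v * ((n - size rs) * n)) ->
  (n - size rs') * A < (n - size rs) * n.
Proof.
move=> sub uniq_rs uniq_rs' size_lt heavy.
rewrite -(card_alive uniq_rs'); set z := n - size rs; set e := num_edges _ _ in heavy.
have z_gt0 : 0 < z by rewrite subn_gt0.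
have : #|alive rs'| * (2 * (A * e)).+1 <= 2 * e * (z * n).
  rewrite -(handshake G) big_distrl -sum_nat_const /=.
  apply: (@leq_trans (\sum_(v in alive rs') degree_in G (alive rs) v * (z * n))).
    by apply: leq_sum => v; rewrite inE => /heavy.
  by rewrite [X in _ <= X](big_setID (alive rs')) /= (setIidPr (alive_sub sub))
      leq_addr.
have zn_gt0 : 0 < z * n by rewrite muln_gt0 z_gt0.
move: #|_| => z'; case: z' => // z'; case: (posnP e) => [->|e_gt0] le_z; first by lia.
rewrite -(@ltn_pmul2l (2 * e)) ?muln_gt0 //; apply: leq_trans le_z; lia.
Qed.

(** The best set met so far was alive at some earlier moment, so the vertices
    outside of it form a suffix rb of rs. *)
Definition peeled s rs := encodes s rs /\ exists pre rb,
  let eb := num_edges G (alive rb) in let zb := n - size rb in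
  [/\ rs = pre ++ rb, size rb < n, reg s rBestEdges = eb, reg s rBestSize = zb
    & covers rs eb zb].

(** [enough T z] is meant to say that T rounds delete any z vertices. *)
Lemma peeling_loop_halts (enough : nat -> nat -> Prop) :
  (forall T z z', enough T z -> 0 < z <= n -> z' * A < z * n ->
     exists2 T', T = T'.+1 & enough T' z') ->
  forall T s rs, peeled s rs -> enough T (n - size rs) ->
  halts (While rSize round_prog) s (T * (26 * weight B + 45 * n + 21) + 1)
    (fun s' => exists2 rs', peeled s' rs' & size rs' = n).
Proof.
move=> enough_step; elim=> [|T IH] s rs [enc [pre [rb [rsE size_rb sE sZ cov]]]] fuel.
  (* A vertex is left without any round to delete it: the shrinking hypothesis
     with z' = 0 excludes this. *)
  have [size_rs|size_lt] := leqP n (size rs); last first.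
    by have [|//|//] := enough_step _ _ 0 fuel; rewrite ?subn_gt0 ?size_lt
        ?leq_subr ?mul0n ?muln_gt0 ?subn_gt0 ?size_lt.
  apply: halts_while_false; first by rewrite (enc_size enc); apply/eqP.
  exists rs; first by split=> //; exists pre, rb.
  apply/eqP; rewrite eqn_leq size_rs andbT -[X in _ <= X]card_ord.
  by rewrite -(card_uniqP (enc_uniq enc)) max_card.
have [size_rs|size_lt] := leqP n (size rs).
  apply: halts_le; first apply: halts_while_false; last by lia.
    by rewrite (enc_size enc); apply/eqP.
  exists rs; first by split=> //; exists pre, rb.
  apply/eqP; rewrite eqn_leq size_rs andbT -[X in _ <= X]card_ord.
  by rewrite -(card_uniqP (enc_uniq enc)) max_card.
set e := num_edges G (alive rs); set z := n - size rs.
have z_gt0 : 0 < z by rewrite subn_gt0.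
set eb := num_edges G (alive rb) in sE cov *; set zb := n - size rb in sZ cov *.
have zb_gt0 : 0 < zb by rewrite subn_gt0.
pose better := eb * z < e * zb.
pose rb' := if better then rs else rb.
pose eb' := if better then e else eb; pose zb' := if better then z else zb.
have [eb'E zb'E] : eb' = num_edges G (alive rb') /\ zb' = n - size rb'.
  by rewrite /eb' /zb' /rb'; case: (better).
have cov' : covers rs eb' zb'.
  rewrite /eb' /zb' /better; case: ltnP => // lt_eb; exact: covers_better (ltnW
      lt_eb) cov.
have le_e : e * zb' <= eb' * z by rewrite /eb' /zb' /better; case: ltnP; lia.
pose P rs' := (exists pre', rs' = pre' ++ rs) /\ covers rs' eb' zb'.
apply: (halts_le (T := ((26 * weight B + 45 * n + 20) +
  (T * (26 * weight B + 45 * n + 21) + 1)).+1)); last by lia.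
apply: halts_while_true.
- by rewrite (enc_size enc) -lt0n.
- apply: (round_prog_halts (P := P) enc sE sZ).
  + exact: num_edges_le.
  + exact: leq_subr.
  + move=> rs' v [[pre' ->] cov1] lv; split; first by exists (v :: pre').
    exact: covers_light lv cov1.
  + by split=> //; exists [::].
move=> s' [sE' sZ' [rs' [enc' [[pre' rsE'] cov1] heavy]]].
have sub : {subset rs <= rs'} by move=> x; rewrite rsE' mem_cat orbC => ->.
have shrink := heavy_shrink sub (enc_uniq enc) (enc_uniq enc') size_lt heavy.
have [|_ [<-] fuel'] := enough_step _ _ _ fuel _ shrink.
  by rewrite subn_gt0 size_lt leq_subr.
apply: IH fuel'; split=> //; rewrite -/z -/e -/better -/eb' -/zb' in sE' sZ'.
have [pre1 rsE1] : exists pre1, rs = pre1 ++ rb'.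
  by rewrite /rb'; case: (better); [exists [::]|exists pre].
exists (pre' ++ pre1), rb'; rewrite /= -eb'E -zb'E; split=> //.
  by rewrite rsE' {1}rsE1 catA.
by rewrite /rb'; case: (better).
Qed.

Definition below q : {set 'I_n} := [set u : 'I_n | u < q].

Lemma belowD1 (v : 'I_n) : below v.+1 :\ v = below v.
Proof. by apply/setP=> u; rewrite !inE ltnS [RHS]ltn_neqAle. Qed.

Definition built s q :=
  [/\ params s, intact s, counts s (below q),
      forall a, W <= a < count -> memory s a = 0
    & reg s rEdges = num_edges G (below q)].

Definition insert_scratch := rEdges :: degree_scratch.

Lemma insert_prog_halts s (v : 'I_n) :
  built s v -> reg s rV = v -> reg s rVDir = vdir + 2 * v ->
  halts insert_prog s (26 * size (cb_pointers r v) + 18) (fun s' =>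
    built s' v.+1 /\ agree insert_scratch s s').
Proof.
move=> [par int cnt zero e] sV sVD; have ltv := ltn_ord v.
have vS : v \in below v.+1 by rewrite inE.
have eE : num_edges G (below v.+1) = num_edges G (below v) + degree_in G (below v) v.
  rewrite (num_edges_del G vS) belowD1; congr (_ + _).
  apply: eq_card => u; rewrite !inE ltnS leq_eqVlt.
  by case: eqP => [/val_inj ->|//]; rewrite adj_irr !andbF.
have e_le := num_edges_le G (below v.+1).
have nn_le : n * n <= n * n * (n * n) by rewrite leq_pmulr ?muln_gt0 ?n_gt0.
have loc_high p : count <= loc p by rewrite /loc; lia.
eapply halts_le.
  apply: halts_seq; first by apply: (@degree_prog_halts _ (below v) v).
  move=> s1 [ag1 m1 d1].
  apply: (halts_op (z := num_edges G (below v.+1))).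
    by rewrite d1 ag1 // e eE evalD // -eE; lia.
  apply: halts_seq.
    apply: (@update_prog_halts _ v OAdd succn).
    - by apply: (params_agree (scr := insert_scratch)) par => // x xs;
        rewrite -(ag1 x); [move: x xs; frame|apply: contra xs; rewrite !inE; do
            ![case: eqP => //= _]].
    - by move=> a lta; rewrite /= m1 int.
    - by rewrite /= /upd /= ag1.
    - move=> p pv; rewrite /= m1 cnt ?(pointer_lt pv) // evalD addn1 //.
      by apply: leq_ltn_trans (_ : n.+1 < _); [rewrite ltnS (leq_trans (max_card
          _)) ?card_ord|lia].
  move=> s2 [ag2 m2]; apply: halts_nil.
  have ag : agree insert_scratch s (set_reg s2 rJunk 0).
    move=> x xs; rewrite /= /upd; case: eqP xs => [->//|_ xs].
    rewrite ag2; last by apply: contra xs; rewrite !inE; do ![case: eqP => //= _].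
    rewrite /= /upd; case: eqP xs => [->//|_ xs].
    by rewrite ag1 //; apply: contra xs; rewrite !inE; do ![case: eqP => //= _].
  have low a : a < count -> memory s2 a = memory s a.
    by move=> lta; rewrite m2 /= m1 ifN //; apply/mapP=> -[p _ E]; have :=
        loc_high p; lia.
  split=> //; split=> //=.
  - exact: params_agree ag par.
  - by move=> a lta; rewrite /= low ?int //; rewrite /count; lia.
  - apply: (counts_update (f := succn) (v := v) (S := below v)) (m2) _.
      by move=> p ltp; rewrite /= m1 cnt.
    move=> p; rewrite /side_count -belowD1 setIDA [LHS](cardsD1 v) inE vS andbT.
    by case: (v \in _).
  - by move=> a /andP[lea lta]; rewrite low // zero // lea.
  - by rewrite /upd /= ag2.
lia.
Qed.

Hypothesis last_block : forall v : 'I_n, v.+1 = n ->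
  baddr v + 2 * size (cb_pointers r v) = W.

(** At the end all vertices are deleted: the coverage inequality has lost its
    first term, and the order array starts with the best set. *)
Lemma peeling_prog_halts (enough : nat -> nat -> Prop) T s :
  (forall T z z', enough T z -> 0 < z <= n -> z' * A < z * n ->
     exists2 T', T = T'.+1 & enough T' z') ->
  enough T n ->
  [seq reg s x | x <- [:: rZero; rOne; rTwo; rN; rK; rAlpha]]
    = [:: 0; 1; 2; n; k; A] ->
  intact s -> (forall a, W <= a -> memory s a = 0) ->
  halts peeling_prog s (T.+1 * (26 * weight B + 45 * n + 21) + 30) (fun s' =>
    exists S : {set 'I_n}, [/\ outputs w s' S, S != set0
      & forall T : {set 'I_n}, num_edges G T * (n * #|S|)
                               <= 2 * (A * num_edges G S) * #|T|]).
Proof.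
move=> enough_step fuel [s0 s1 s2 sN sK sA] int zero.
pose v := Ordinal (etrans (f_equal (leq^~ n) (prednK n_gt0)) (leqnn n)).
have v1 : v.+1 = n by rewrite /= prednK.
have [dir0 dir1] := input_dir v; have W_E := last_block v1.
have header3 : header_size = 3 by [].
have vdE : vdir + n + n - 2 = vdir + 2 * v by lia.
eapply halts_le.
  apply: (halts_op (z := 2 * k)); first by rewrite sK evalD; lia.
  apply: (halts_op (z := 4 * k)); first by rewrite /= /upd /= evalD; lia.
  apply: halts_const; first by lia.
  apply: (halts_op (z := vdir)); first by rewrite /= /upd /= evalD; rewrite
      /vdir; lia.
  apply: (halts_op (z := vdir + n)); first by rewrite /= /upd /= sN evalD; lia.
  apply: (halts_op (z := vdir + n + n)); first by rewrite /= /upd /= sN evalD; lia.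
  apply: (halts_op (z := vdir + 2 * v)).
    by rewrite -vdE /= /upd /= s2 evalB; lia.
  apply: (halts_read (z := 2 * size (cb_pointers r v))).
    by rewrite /= /upd /= int ?dir0 //; lia.
  apply: (halts_op (z := vdir + 2 * v + 1)).
    by rewrite /= /upd /= s1 evalD; lia.
  apply: (halts_read (z := baddr v)).
    by rewrite /= /upd /= int ?dir1 //; lia.
  apply: (halts_op (z := order)).
    by rewrite /= /upd /= evalD; rewrite /order; lia.
  apply: (halts_op (z := dead)).
    by rewrite /= /upd /= sN evalD; rewrite /order /dead; lia.
  apply: (halts_op (z := count)).
    by rewrite /= /upd /= sN evalD; rewrite /count /dead; lia.
  apply: halts_const; first by lia.
  apply: halts_seq.
    apply: (@halts_for_vertices w n vdir insert_prog (fun q => 26 * pointer_count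
        q + 18) (fun q s => built s q)).
    - by lia.
    - by lia.
    - by move=> q s' [par _ _ _ _]; case: par.
    - move=> q s3 s4 [par int3 cnt3 zero3 e3] ag m; split.
      + exact: params_agree ag par.
      + by rewrite /intact -m.
      + by rewrite /counts -m.
      + by rewrite -m.
      + by rewrite ag.
    - move=> q s3 ltq b3 sV sVD; apply: (halts_weaken (insert_prog_halts (v :=
        Ordinal ltq) b3 sV sVD)).
        by rewrite -pointer_count_ord.
      by move=> s4 [b4 ag4]; split; rewrite ?ag4.
    - have below0 : below 0 = set0 by apply/setP=> u; rewrite !inE.
      split.
      + by rewrite /params /= /upd /= s0 s1 s2 sN sA.
      + exact: int.
      + move=> p _; rewrite /= zero; last by rewrite /loc /count; lia.
        by rewrite /side_count below0 setI0 cards0.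
      + by move=> a /andP[lea _]; apply: zero.
      + by rewrite /= /upd /= below0 num_edges0.
  move=> s3 [par3 int3 cnt3 zero3 e3].
  have [t0 tN tO] : [/\ reg s3 rZero = 0, reg s3 rN = n & reg s3 rOrder = order].
    by case: par3.
  have all_alive : below n = alive [::] by apply/setP=> u; rewrite !inE ltn_ord.
  rewrite all_alive in cnt3 e3.
  have e_le := num_edges_le G (alive [::]).
  have nn_le : n * n <= n * n * (n * n) by rewrite leq_pmulr ?muln_gt0 ?n_gt0.
  apply: (halts_op (z := n)); first by rewrite t0 tN evalD; lia.
  apply: (halts_op (z := num_edges G (alive [::]))).
    by rewrite /= /upd /= e3 t0 evalD ?addn0 //; lia.
  apply: (halts_op (z := n)); first by rewrite /= /upd /= tN t0 evalD; lia.
  apply: halts_seq.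
    apply: (@peeling_loop_halts enough enough_step T _ [::]); last by rewrite subn0.
    split.
      split=> //.
      + by move=> u; rewrite /= zero3 //; rewrite /dead /count; have := ltn_ord
          u; lia.
      + by rewrite subn0.
    exists [::], [::]; rewrite subn0; split=> // X.
    have -> : X :&: alive [::] = X by apply/setP=> u; rewrite !inE andbT.
    exact: leq_addr.
  move=> s4 [rs [enc4 [pre [rb [rsE size_rb sE sZ cov]]]] size_rs].
  have [par4 _ _ _ ord4 uniq4 _ _] := enc4.
  have [u0 uO] : reg s4 rZero = 0 /\ reg s4 rOrder = order by case: par4.
  apply: (halts_op (z := n - size rb)).
    by rewrite sZ u0 evalD; lia.
  apply: (halts_op (z := order)).
    by rewrite /= /upd /= uO u0 evalD; rewrite /order; lia.
  apply: halts_nil.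
  have size_pre : size pre = n - size rb by have := size_rs; rewrite rsE
      size_cat; lia.
  have uniq_rb : uniq rb by move: uniq4; rewrite rsE cat_uniq => /and3P[].
  have alive_rb : alive rb = [set u in pre].
    apply/setP=> u; rewrite !inE.
    have : u \in rs.
      have [||_ ->] := @uniq_min_size _ rs (enum 'I_n) uniq4; rewrite ?mem_enum //.
        by move=> x _; rewrite mem_enum.
      by rewrite size_rs size_enum_ord.
    rewrite rsE mem_cat; move: uniq4; rewrite rsE cat_uniq => /and3P[_ /hasPn dis _].
    by case: (boolP (u \in rb)) => [/dis/negPf ->|_]; rewrite ?orbF.
  exists (alive rb); split.
  - exists pre; split=> //.
    + by move: uniq4; rewrite rsE cat_uniq => /and3P[].
    + by rewrite /= /upd /= size_pre; rewrite /order; lia.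
    + apply: (@eq_from_nth _ 0); rewrite !size_map ?size_iota // => j ltj.
      rewrite (nth_map 0) ?size_iota // nth_iota // add0n /= /upd /=.
      have := ord4 j; rewrite size_rs subnn addn0 => ->; last first.
        by apply: leq_trans ltj _; rewrite size_pre leq_subr.
      by rewrite rsE map_cat nth_cat size_map ltj.
  - by rewrite -card_gt0 card_alive // subn_gt0.
  - move=> X; rewrite card_alive //; apply: leq_trans (cov X) _.
    have -> : alive rs = set0.
      by apply/eqP; rewrite -cards_eq0 card_alive // size_rs subnn.
    by rewrite setI0 setD0 num_edges0.
rewrite sum_pointer_count; lia.
Qed.

End Machine.

(** * The program on an encoded representation *)

Import Order.TTheory GRing.Theory Num.Theory.

Section Instance.
Context {R : realType} {n : nat} (G : sgraph n) (B : seq (vpair n)) (r : cb_rep n).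
Variables (w : nat) (alpha : R).
Hypothesis partB : biclique_partition G B.
Hypothesis repB : cb_represents B r.
Let k := size B.
Let input := cb_input w r alpha.
Let A := alpha_word w n alpha.
Let vdir := header_size + 4 * k.
Let vertex_addr (v : 'I_n) := block_addr r (2 * k + v).

Lemma size_cb_lists : size (cb_lists r) = k.
Proof. by have [BE _ _ _] := repB; rewrite /k BE size_map. Qed.

Lemma size_vertex_block (v : 'I_n) :
  size (nth [::] (cb_blocks r) (2 * k + v)) = 2 * size (cb_pointers r v).
Proof. by rewrite -size_cb_lists nth_cb_blocks_vertex size_flatten_pairs. Qed.

Lemma cb_input_vertex (v : 'I_n) :
  nth 0 input (vdir + 2 * v) = 2 * size (cb_pointers r v) /\
  nth 0 input (vdir + 2 * v + 1) = vertex_addr v.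
Proof.
have -> : vdir + 2 * v = header_size + 2 * (2 * k + v) by rewrite /vdir; lia.
rewrite -size_vertex_block; apply: cb_input_directory.
by rewrite size_cb_blocks size_cb_lists; have := ltn_ord v; lia.
Qed.

Lemma cb_input_pointer (v : 'I_n) j : j < size (cb_pointers r v) ->
  nth 0 input (vertex_addr v + 2 * j)
    = biclique_addr (nth (0, false) (cb_pointers r v) j).1 /\
  nth 0 input (vertex_addr v + 2 * j + 1) = (nth (0, false) (cb_pointers r v) j).2.
Proof.
move=> ltj; have sz := size_vertex_block v.
rewrite -addnA !cb_input_block ?sz; try lia.
rewrite -size_cb_lists nth_cb_blocks_vertex.
exact: (nth_flatten_pairs (fun p => biclique_addr p.1) (fun p => nat_of_bool p.2)
    _ ltj).
Qed.

Lemma vertex_addr_le (v : 'I_n) :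
  vertex_addr v + 2 * size (cb_pointers r v) <= size input.
Proof. by rewrite -size_vertex_block block_addr_le. Qed.

Lemma last_vertex_addr (v : 'I_n) : v.+1 = n ->
  vertex_addr v + 2 * size (cb_pointers r v) = size input.
Proof.
move=> v1; rewrite -size_vertex_block; apply: last_block_addr.
by rewrite size_cb_blocks size_cb_lists; lia.
Qed.

(** The sides use one word per vertex, the pointers two words each. *)
Lemma size_cb_blocks_flatten : size (flatten (cb_blocks r)) = 3 * weight B.
Proof.
have [BE sorted_l _ _] := repB.
rewrite /cb_blocks flatten_cat size_cat !size_flatten_sum.
have -> : 3 * weight B = weight B + 2 * weight B by lia.
congr (_ + _).
  rewrite big_flatten big_map /weight BE big_map !big_seq; apply: eq_bigr => l l_in.
  have card_l (t : seq 'I_n) : sorted ltn (map val t) -> #|[set v in t]| = size t.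
    move=> /(sorted_uniq ltn_trans ltnn); rewrite (map_inj_uniq val_inj).
    by move/card_uniqP <-; rewrite cardsE.
  have [s1 s2] := sorted_l l l_in.
  by rewrite !big_cons big_nil !size_map !card_l //= addn0.
rewrite big_map -(sum_size_pointers repB) big_distrr /= big_enum /=.
by apply: eq_bigr => v _; rewrite size_flatten_pairs.
Qed.

Lemma size_input : size input = 3 + 4 * k + 2 * n + 3 * weight B.
Proof.
rewrite size_cb_input size_cb_blocks_flatten size_cb_blocks size_cb_lists.
by rewrite /header_size; lia.
Qed.

Lemma edge_prog_halts s :
  1 < n -> 6 < 2 ^ w ->
  [seq reg s x | x <- [:: rZero; rOne; rK]] = [:: 0; 1; k] ->
  memory s = nth 0 input ->
  halts (w := w) edge_prog s 12 (fun s' =>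
    exists S : {set 'I_n}, [/\ outputs w s' S, S != set0
      & #|S| <= 2 * num_edges G S \/ edges G = set0]).
Proof.
move=> n_gt1 lt2 [s0 s1 sK] m.
have [BE _ _ _] := repB.
apply: halts_if => [k_gt0|k0].
  have {}k_gt0 : 0 < k by rewrite lt0n -sK.
  pose l := nth ([::], [::]) (cb_lists r) 0.
  have nth_l : nth (set0, set0) B 0 = ([set v in l.1], [set v in l.2]).
    by rewrite BE (nth_map ([::], [::])) ?size_cb_lists.
  have [] := partB.1 (nth (set0, set0) B 0) (mem_nth _ k_gt0); rewrite nth_l /=.
  case E1 : l.1 => [|x l1] /=; first by rewrite set_nil ?eqxx.
  case E2 : l.2 => [|y l2] /=; first by rewrite set_nil ?eqxx.
  move=> _ _ _ adj_l.
  have Gxy : G x y by apply: adj_l; rewrite !inE eqxx.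
  have xy := adj_neq Gxy.
  have side0 := @nth_cb_blocks_side _ r 0 false; have side1 :=
      @nth_cb_blocks_side _ r 0 true.
  rewrite size_cb_lists in side0 side1.
  move: (side0 k_gt0) (side1 k_gt0); rewrite -/l /= E1 E2 /= => b0 b1.
  have size_blocks : 1 < size (cb_blocks r) by rewrite size_cb_blocks
      size_cb_lists; lia.
  have [_ d0] := cb_input_directory w alpha (ltnW size_blocks).
  have [_ d1] := cb_input_directory w alpha size_blocks.
  have i0 : nth 0 input (block_addr r 0) = x.
    by have := @cb_input_block _ r R w alpha 0 0; rewrite addn0 b0; apply.
  have i1 : nth 0 input (block_addr r 1) = y.
    by have := @cb_input_block _ r R w alpha 1 0; rewrite addn0 b1; apply.
  eapply halts_le.
    apply: halts_const; first by lia.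
    apply: (halts_read (z := block_addr r 0)); first by rewrite /= /upd /= m.
    apply: (halts_read (z := x)); first by rewrite /= /upd /= m.
    apply: halts_const; first by lia.
    apply: (halts_read (z := block_addr r 1)); first by rewrite /= /upd /= m.
    apply: (halts_read (z := y)); first by rewrite /= /upd /= m.
    apply: (halts_write (x := 0) (y := x)) => //.
    apply: (halts_write (x := 1) (y := y)) => //.
    do 2![apply: halts_const; first by lia].
    apply: halts_nil; exists [set x; y]; split.
    - exists [:: x; y]; split=> //=; first by rewrite inE xy.
        by apply/setP=> u; rewrite !inE.
      by rewrite /upd /=; lia.
    - by rewrite -card_gt0 cards2.
    - left; rewrite cards2 xy leq_pmulr //; apply/card_gt0P.
      by exists [set x; y]; apply/edges_inP; exists x, y; rewrite set21 set22.
  by [].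
have B0 : B = [::] by apply: size0nil; rewrite -/k -sK.
eapply halts_le.
  apply: (halts_write (x := 0) (y := 0)) => //.
  apply: halts_const; first by lia.
  apply: halts_const; first by lia.
  apply: halts_nil; exists [set Ordinal (ltnW n_gt1)]; split.
  - by exists [:: Ordinal (ltnW n_gt1)]; split=> //=; [apply/setP=> u; rewrite
      !inE|rewrite /upd /=; lia].
  - by rewrite -card_gt0 cards1.
  - right; apply/setP=> f; rewrite inE; apply/negP=> /partB.2; by rewrite B0.
by [].
Qed.

Hypothesis n_gt1 : 1 < n.
Hypothesis space : size input + n + n + 4 * k + 10 < 2 ^ w.
Hypothesis word_big : 2 * (n * n * (n * n)) < 2 ^ w.

Definition finds (F : {set 'I_n} -> Prop) s :=
  exists S : {set 'I_n}, outputs w s S /\ F S.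

(** The two branches share their preamble, and both are specified by a property
    of the set they output. *)
Lemma densest_prog_dispatch T F :
  (forall s, [seq reg s x | x <- [:: rZero; rOne; rTwo; rN; rK; rAlpha]]
     = [:: 0; 1; 2; n; k; A] -> memory s = nth 0 input ->
     halts (w := w) (if A < n * n then peeling_prog else edge_prog) s T (finds F)) ->
  halts (w := w) densest_prog (init_state input) (T + 10) (finds F).
Proof.
move=> run; have nn_le : n * n <= n * n * (n * n) by rewrite leq_pmulr ?muln_gt0
    ?andbb; lia.
eapply halts_le.
  do 3![apply: halts_const; first by lia].
  apply: (halts_read (z := n)) => //.
  apply: (halts_read (z := k)); first by rewrite /= -size_cb_lists.
  apply: (halts_read (z := A)) => //.
  apply: (halts_op (z := n * n)); first by rewrite /= /upd /= evalM //; lia.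
  apply: (halts_op (z := A < n * n)); first by rewrite /= /upd /= evalLt //; lia.
  apply: halts_seq.
    apply: (halts_if (T := T) (Q := finds F)); move: run; rewrite /= {2}/upd /=;
      by case: (A < n * n) => //= run _; apply: run.
  move=> s' [S [out FS]]; apply: halts_nil; exists S; split=> //.
lia.
Qed.

Lemma densest_prog_edge : n * n <= A ->
  halts (w := w) densest_prog (init_state input) 22
    (finds (fun S => S != set0 /\ (#|S| <= 2 * num_edges G S \/ edges G = set0))).
Proof.
move=> leA; apply: (@densest_prog_dispatch 12) => s [s0 s1 _ _ sK _] m.
rewrite ltnNge leA /=; apply: halts_weaken (edge_prog_halts n_gt1 _ _ m) (leqnn _) _.
- by lia.
- by rewrite /= s0 s1 sK.
- by move=> s' [S [out S0 H]]; exists S.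
Qed.

Lemma densest_prog_peeling (enough : nat -> nat -> Prop) T : A < n * n ->
  (forall T z z', enough T z -> 0 < z <= n -> z' * A < z * n ->
     exists2 T', T = T'.+1 & enough T' z') ->
  enough T n ->
  halts (w := w) densest_prog (init_state input)
    (T.+1 * (26 * weight B + 45 * n + 21) + 40)
    (finds (fun S => S != set0 /\
       forall T : {set 'I_n}, num_edges G T * (n * #|S|)
                              <= 2 * (A * num_edges G S) * #|T|)).
Proof.
move=> ltA enough_step fuel.
apply: (halts_le (T := (T.+1 * (26 * weight B + 45 * n + 21) + 30) + 10)); last
    by lia.
apply: densest_prog_dispatch => s regs m; rewrite ltA.
apply: (halts_weaken (peeling_prog_halts partB repB cb_input_vertex
  cb_input_pointer vertex_addr_le _ space (ltnW n_gt1) ltA word_big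
  last_vertex_addr enough_step fuel regs _ _)) => //.
- by rewrite size_input /header_size; lia.
- by move=> a _; rewrite m.
- by move=> a lea; rewrite m nth_default.
- by move=> s' [S [out S0 H]]; exists S.
Qed.

End Instance.

(** * Approximation ratio and number of rounds *)

Local Open Scope ring_scope.

Section Reals.
Context {R : realType}.
Implicit Types (alpha x : R).

Lemma ln2_gt0 : 0 < ln 2 :> R.
Proof. by apply: ln_gt0; rewrite ltr1n. Qed.

Lemma lg_ge1 n : (1 < n)%N -> 1 <= lg n%:R :> R.
Proof.
move=> n_gt1; rewrite /lg ler_pdivlMr ?ln2_gt0 // mul1r.
by rewrite ler_ln ?posrE ?ltr0n ?ler_nat // ltnW.
Qed.

Lemma lg_gt0 x : 1 < x -> 0 < lg x.
Proof. by move=> x_gt1; apply: divr_gt0; [apply: ln_gt0|apply: ln2_gt0]. Qed.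

Lemma lg_le_nat n : (0 < n)%N -> lg n%:R <= n%:R :> R.
Proof.
move=> n_gt0; rewrite /lg ler_pdivrMr ?ln2_gt0 // mulr_natl -lnXn // -natrX.
by rewrite ler_ln ?posrE ?ltr0n ?expn_gt0 // ler_nat ltnW // ltn_expl.
Qed.

Lemma word_bound n w K : (1 < n)%N -> K%:R * lg n%:R <= w%:R :> R ->
  (n ^ K <= 2 ^ w)%N.
Proof.
move=> n_gt1; have n_gt0 := ltnW n_gt1.
rewrite /lg mulrA ler_pdivrMr ?ln2_gt0 // !mulr_natl -!lnXn ?ltr0n //.
by rewrite ler_ln ?posrE ?exprn_gt0 ?ltr0n // -!natrX ler_nat.
Qed.

Section Rounds.
Variables (n A : nat) (alpha : R).
Hypothesis alpha_gt1 : 1 < alpha.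
Hypothesis alphaA : A%:R <= alpha * n%:R < A.+1%:R.

(** The rounded ratio A / n is at least 1 because alpha is. *)
Lemma alpha_word_ge : (n <= A)%N.
Proof.
have /andP[_ lt] := alphaA.
rewrite -ltnS -(ltr_nat R); apply: le_lt_trans lt.
by rewrite ler_peMl ?ler0n // ltW.
Qed.

(** From alpha n < A + 1 one gets z' alpha n <= z n - 1 + z', and the error
    z' - 1 is absorbed because z' < z <= n.  This holds even when
    alpha < 1 + 1 / n, where A / n carries no information on alpha - 1. *)
Lemma round_shrinks z z' : (z <= n)%N -> (0 < z)%N -> (z' * A < z * n)%N ->
  z'%:R ^+ 2 * alpha <= z%:R ^+ 2 :> R.
Proof.
move=> le_zn z_gt0 lt_z; have leA := alpha_word_ge.
have n_gt0 : (0 < n)%N by lia.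
have lt_zz : (z' < z)%N by nia.
have key : (z' * (z' * A + z') <= z * z * n)%N.
  case: z' lt_z lt_zz => // z' lt_z lt_zz.
  apply: (@leq_trans ((z - 1) * (z * n + z - 2))%N); first by apply: leq_mul; lia.
  nia.
rewrite -(ler_pM2r (_ : 0 < n%:R :> R)) ?ltr0n //.
apply: le_trans (_ : (z' * (z' * A + z'))%:R <= _ :> R); last first.
  by rewrite -natrX -natrM ler_nat -mulnn.
have -> : (z' * A + z' = z' * A.+1)%N by lia.
rewrite expr2 -!mulrA !natrM !ler_wpM2l ?ler0n //.
by have /andP[_ /ltW] := alphaA.
Qed.

(** The square accounts for rounds that shrink the graph by the square root of
    alpha only. *)
Definition enough_rounds (T z : nat) : Prop :=
  z = 0%N \/ z%:R ^+ 2 < alpha ^+ T.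

Lemma enough_rounds_step T z z' : enough_rounds T z -> (0 < z <= n)%N ->
  (z' * A < z * n)%N -> exists2 T', T = T'.+1 & enough_rounds T' z'.
Proof.
move=> [->//|lt_T] /andP[z_gt0 le_z] lt_z.
have shrink := round_shrinks le_z z_gt0 lt_z.
case: T lt_T => [|T] lt_T.
  by move: lt_T; rewrite expr0 -natrX -[X in _ < X]/1%:R ltr_nat ltnNge expn_gt0
      z_gt0.
exists T => //; right; have alpha_gt0 : 0 < alpha := lt_trans ltr01 alpha_gt1.
by rewrite -(ltr_pM2r alpha_gt0) -exprSr; apply: le_lt_trans lt_T.
Qed.

End Rounds.

Definition num_rounds n alpha : nat := (Num.truncn (2 * lg n%:R / lg alpha)).+1.

Lemma enough_num_rounds n alpha : (0 < n)%N -> 1 < alpha ->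
  enough_rounds alpha (num_rounds n alpha) n.
Proof.
move=> n_gt0 alpha_gt1; right; have alpha_gt0 : 0 < alpha := lt_trans ltr01 alpha_gt1.
rewrite -ltr_ln ?posrE ?exprn_gt0 ?ltr0n // !lnXn ?ltr0n //.
rewrite -[ltLHS]mulr_natl -[ltRHS]mulr_natl.
rewrite -ltr_pdivrMr ?ln_gt0 //.
suff -> : 2%:R * ln n%:R / ln alpha = 2 * lg n%:R / lg alpha by apply: truncnS_gt.
rewrite /lg; field.
by rewrite (gt_eqF ln2_gt0) (gt_eqF (ln_gt0 alpha_gt1)).
Qed.

Lemma approx_densestI n (G : sgraph n) alpha (S : {set 'I_n}) :
  0 < alpha -> S != set0 ->
  (forall T : {set 'I_n}, T != set0 ->
     density R G T <= 2 * alpha * density R G S) ->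
  approx_densest G (2 * alpha) S.
Proof.
move=> alpha_gt0 S0 le_T; split=> //.
have a2_gt0 : 0 < 2 * alpha by rewrite mulr_gt0.
rewrite ler_pdivrMl //; apply: bigmax_le => //.
by rewrite mulr_ge0 ?(ltW a2_gt0) // /density divr_ge0 ?ler0n.
Qed.

Lemma approx_peeling n A (G : sgraph n) alpha (S : {set 'I_n}) :
  (0 < n)%N -> 1 < alpha -> A%:R <= alpha * n%:R -> S != set0 ->
  (forall T : {set 'I_n}, (num_edges G T * (n * #|S|)
                          <= 2 * (A * num_edges G S) * #|T|)%N) ->
  approx_densest G (2 * alpha) S.
Proof.
move=> n_gt0 alpha_gt1 leA S0 cov.
have alpha_gt0 : 0 < alpha := lt_trans ltr01 alpha_gt1.
apply: approx_densestI => // T T0.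
have n_pos : 0 < n%:R :> R by rewrite ltr0n.
have S_pos : 0 < #|S|%:R :> R by rewrite ltr0n card_gt0.
have T_pos : 0 < #|T|%:R :> R by rewrite ltr0n card_gt0.
rewrite /density -!/(num_edges G _) ler_pdivrMr //.
rewrite -(ler_pM2r (mulr_gt0 n_pos S_pos)).
have := cov T; rewrite -(ler_nat R) !natrM => /le_trans; apply.
set e := (num_edges G S)%:R; set s := #|S|%:R in S_pos *.
have -> : 2 * alpha * (e / s) * #|T|%:R * (n%:R * s) = 2 * (alpha * n%:R * e) *
    #|T|%:R.
  by field; rewrite gt_eqF.
by rewrite ler_wpM2r ?ler0n // ler_wpM2l // ler_wpM2r ?ler0n.
Qed.

(** Every density is at most n / 2 by the handshake identity. *)
Lemma approx_edge n (G : sgraph n) alpha (S : {set 'I_n}) :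
  1 < alpha -> n%:R <= alpha -> S != set0 ->
  (#|S| <= 2 * num_edges G S)%N \/ edges G = set0 ->
  approx_densest G (2 * alpha) S.
Proof.
move=> alpha_gt1 le_alpha S0 S_edge.
have alpha_gt0 : 0 < alpha := lt_trans ltr01 alpha_gt1.
apply: approx_densestI => // T T0.
have S_pos : 0 < #|S|%:R :> R by rewrite ltr0n card_gt0.
have T_pos : 0 < #|T|%:R :> R by rewrite ltr0n card_gt0.
rewrite /density -!/(num_edges G _) ler_pdivrMr //.
case: S_edge => [le_S|no_edge]; last first.
  have -> : num_edges G T = 0%N.
    apply/eqP; rewrite cards_eq0 -subset0 -no_edge; apply/subsetP=> f.
    by case/edges_inP=> x [y [_ _ Gxy ->]]; apply/edges_inP; exists x, y; rewrite
        !inE.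
  by rewrite !mulr_ge0 ?invr_ge0 ?ler0n // ltW.
have le_e : (2 * num_edges G T <= #|T| * n)%N.
  by rewrite -handshake -sum_nat_const; apply: leq_sum => v _; apply: degree_in_le.
have le_eR : 2 * (num_edges G T)%:R <= #|T|%:R * n%:R :> R.
  by rewrite -!natrM ler_nat.
have dS : 1 <= 2 * ((num_edges G S)%:R / #|S|%:R) :> R.
  by rewrite mulrA ler_pdivlMr // mul1r -natrM ler_nat.
set d := _ / _ in dS *.
apply: (@le_trans _ _ (alpha * 1 * #|T|%:R)); last first.
  rewrite ler_wpM2r ?ler0n // [2 * alpha]mulrC -mulrA ler_wpM2l //.
  exact: ltW.
have le_an : #|T|%:R * n%:R <= #|T|%:R * alpha by rewrite ler_wpM2l ?ler0n.
have : 0 <= (num_edges G T)%:R :> R by [].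
lra.
Qed.

End Reals.

(** * The main result *)

(** The summand cn in the exponent makes words long enough for a weight of
    cn * n * n, as 2 ^ cn exceeds cn. *)
Lemma word_room n w cn k wt : (1 < n)%N -> (k <= wt)%N ->
  (wt <= cn * (n * n))%N -> (n ^ (cn + 10) <= 2 ^ w)%N ->
  (3 + 4 * k + 2 * n + 3 * wt + n + n + 4 * k + 10 < 2 ^ w)%N /\
  (2 * (n * n * (n * n)) < 2 ^ w)%N.
Proof.
move=> n_gt1 le_k le_wt le_w; have n_gt0 := ltnW n_gt1.
have le_pow : (64 * (cn + 1) * (n * n * (n * n)) <= 2 ^ w)%N.
  apply: leq_trans le_w; have -> : (cn + 10 = (cn + 6) + 4)%N by lia.
  rewrite expnD; have -> : (n ^ 4 = n * n * (n * n))%N by rewrite !expnS expn0; lia.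
  rewrite leq_mul2r; apply/orP; right.
  apply: (@leq_trans (2 ^ (cn + 6))); last by rewrite leq_exp2r // addn_gt0 orbT.
  by rewrite expnD mulnC; apply: leq_mul => //; rewrite addn1 ltn_expl.
have sq_gt0 : (0 < n * n)%N by rewrite muln_gt0 n_gt0.
have le_nn : (n <= n * n)%N by rewrite leq_pmulr.
have le_n4 : (n * n <= n * n * (n * n))%N by rewrite leq_pmulr.
have le_c4 : (cn * (n * n) <= cn * (n * n * (n * n)))%N by rewrite leq_mul2l
    le_n4 orbT.
by move: le_pow; rewrite mulnDr muln1 mulnDl -mulnA; lia.
Qed.

(** There are at most 4 lg n / lg alpha rounds, since lg alpha <= lg n, and a
    round takes time O(n^2 / lg n). *)
Lemma time_bound (R : realType) n wt cn (alpha : R) :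
  (1 < n)%N -> 1 < alpha -> alpha <= n%:R ->
  wt%:R * lg n%:R <= cn%:R * n%:R ^+ 2 :> R ->
  ((num_rounds n alpha).+1 * (26 * wt + 45 * n + 21) + 40)%:R
    <= (104 * cn + 400)%:R * (n%:R ^+ 2 / lg alpha) :> R.
Proof.
move=> n_gt1 alpha_gt1 le_alpha le_wt; have n_gt0 := ltnW n_gt1.
have Ln_ge1 := @lg_ge1 R n n_gt1; have Ln_le := @lg_le_nat R n n_gt0.
have La_gt0 := lg_gt0 alpha_gt1.
have La_le : lg alpha <= lg n%:R.
  rewrite /lg ler_pM2r ?invr_gt0 ?ln2_gt0 // ler_ln // posrE ?ltr0n //.
  exact: lt_trans alpha_gt1.
rewrite /num_rounds; set La := lg alpha in La_gt0 La_le *.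
set Ln := lg n%:R in Ln_ge1 Ln_le La_le le_wt *.
set T := Num.truncn _; have T_le : T%:R <= 2 * Ln / La :> R.
  rewrite truncn_le; apply: divr_ge0 (ltW La_gt0); apply: mulr_ge0 => //.
  exact: le_trans Ln_ge1.
have n_ge1 : 1 <= n%:R :> R by rewrite ler1n.
rewrite mulrA ler_pdivlMr //.
have TLa : T.+2%:R * La <= 4 * Ln.
  rewrite -addn2 natrD mulrDl.
  have : T%:R * La <= 2 * Ln by rewrite -ler_pdivlMr.
  lra.
have work : (26 * wt + 45 * n + 21)%:R * Ln <= (26 * cn%:R + 66) * n%:R ^+ 2.
  rewrite natrD natrD natrM natrM.
  have : n%:R * Ln <= n%:R ^+ 2 by rewrite expr2 ler_wpM2l ?ler0n.
  have : Ln <= n%:R ^+ 2 by rewrite expr2; nra.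
  lra.
rewrite natrD natrM mulrDl mulrAC.
set W := _%:R in work *; have W_ge0 : 0 <= W by apply: ler0n.
have step : T.+2%:R * La * W <= 4 * ((26 * cn%:R + 66) * n%:R ^+ 2).
  apply: (@le_trans _ _ (4 * Ln * W)); first by rewrite ler_wpM2r.
  by rewrite -mulrA [Ln * W]mulrC ler_wpM2l.
have La_sq : La <= n%:R ^+ 2 by rewrite expr2; nra.
have sq_ge0 : 0 <= n%:R ^+ 2 :> R by apply: exprn_ge0.
rewrite natrD natrM; lra.
Qed.

Unset Implicit Arguments.

Theorem mainTheorem4 (R : realType) :
  exists p : prog, forall c : R, exists (K : nat) (C : R),
    forall (n w : nat) (G : sgraph n) (B : seq (vpair n)) (r : cb_rep n)
           (alpha : R),
      (1 < n)%N ->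
      biclique_partition G B ->
      (weight B)%:R <= c * (n%:R ^+ 2 / lg n%:R) ->
      cb_represents B r ->
      1 < alpha ->
      K%:R * lg n%:R <= w%:R :> R ->
      exists (s : state) (t : nat) (S : {set 'I_n}),
        [/\ exec w p (init_state (cb_input w r alpha)) s t,
            outputs w s S,
            approx_densest G (2 * alpha) S
          & t%:R <= C * Num.max 1 (n%:R ^+ 2 / lg alpha)].
Proof.
exists densest_prog => c; pose cn := (Num.truncn `|c|).+1.
exists (cn + 10)%N, (104 * cn + 400)%:R => n w G B r alpha n_gt1 partB le_wt repB
    alpha_gt1 le_w.
have n_gt0 := ltnW n_gt1; have alpha_gt0 : 0 < alpha := lt_trans ltr01 alpha_gt1.
have Ln_ge1 := @lg_ge1 R n n_gt1.
have Ln_gt0 : 0 < lg n%:R :> R := lt_le_trans ltr01 Ln_ge1.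
have sq_ge0 : 0 <= n%:R ^+ 2 :> R by apply: exprn_ge0.
have le_wt_lg : (weight B)%:R * lg n%:R <= cn%:R * n%:R ^+ 2 :> R.
  rewrite -ler_pdivlMr // -mulrA; apply: le_trans le_wt _.
  apply: ler_wpM2r; first exact: divr_ge0 (ltW Ln_gt0).
  by apply: le_trans (ler_norm c) _; apply/ltW/truncnS_gt.
have le_wt_nat : (weight B <= cn * (n * n))%N.
  rewrite -(ler_nat R) natrM natrM -expr2; apply: le_trans le_wt_lg.
  by rewrite ler_peMr ?ler0n.
have [room big] := word_room n_gt1 (size_le_weight partB) le_wt_nat (word_bound
    n_gt1 le_w).
rewrite -(size_input w alpha repB) in room.
have max_ge x : x <= Num.max 1 x :> R by rewrite le_max lexx orbT.
have C_ge0 : 0 <= (104 * cn + 400)%:R :> R by apply: ler0n.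
have itvA := truncn_itv (mulr_ge0 (ltW alpha_gt0) (ler0n R n)).
set A := alpha_word w n alpha.
have [leA|ltA] := leqP (n * n) A.
  have [s [t [ex le_t [S [out [S0 edge]]]]]] := densest_prog_edge partB repB
      n_gt1 room big leA.
  exists s, t, S; split=> //.
    apply: approx_edge => //; rewrite -(ler_pM2r (_ : 0 < n%:R :> R)) ?ltr0n //.
    have /andP[le_trunc _] := itvA; apply: le_trans le_trunc.
    by rewrite -natrM ler_nat (leq_trans leA) // /A /alpha_word geq_minl.
  apply: (@le_trans _ _ ((104 * cn + 400)%:R * 1)).
    by rewrite mulr1 ler_nat; lia.
  by rewrite ler_wpM2l // le_max lexx.
have AE : A = Num.truncn (alpha * n%:R).
  have nn_le : (n * n <= n * n * (n * n))%N by rewrite leq_pmulr ?muln_gt0 ?n_gt0.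
  by move: ltA; rewrite /A /alpha_word /minn; case: (ltnP _ (2 ^ w).-1) => //; lia.
have itvA' : A%:R <= alpha * n%:R < A.+1%:R by rewrite AE.
have /andP[leA gtA] := itvA'.
have le_alpha : alpha <= n%:R.
  rewrite -(ler_pM2r (_ : 0 < n%:R :> R)) ?ltr0n //; apply: le_trans (ltW gtA) _.
  by rewrite -natrM ler_nat.
have [s [t [ex le_t [S [out [S0 cov]]]]]] := densest_prog_peeling partB repB
    n_gt1 room
  big ltA (fun T z z' => @enough_rounds_step R n A alpha alpha_gt1 itvA' T z z')
  (enough_num_rounds n_gt0 alpha_gt1).
exists s, t, S; split=> //; first exact: approx_peeling leA S0 cov.
apply: (@le_trans _ _ ((104 * cn + 400)%:R * (n%:R ^+ 2 / lg alpha))).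
  apply: le_trans (time_bound n_gt1 alpha_gt1 le_alpha le_wt_lg).
  by rewrite ler_nat.
by rewrite ler_wpM2l.
Qed.
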